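(* Let $n\ge1$, $\delta>0$ and $\beta<n+2$, and let $\mathbf u\in(C^3(\mathbb{R}^n))^n$ and $x\in\mathbb{R}^n$. Let $$\mathcal L_b\mathbf u(x)=(n+2)\mu\, c^{\delta,\beta}\int_{B_\delta(0)}\frac{w\otimes w}{\|w\|^{\beta+2}}\,(\mathbf u(x+w)-\mathbf u(x))\,dw .$$ Then for fixed $\beta$, $$\lim_{\delta\to0^+}\mathcal L_b\mathbf u(x)=\mu\Delta\mathbf u(x)+2\mu\nabla(\nabla\cdot\mathbf u)(x),$$ and for fixed $\delta$, $$\lim_{\beta\to (n+2)^-}\mathcal L_b\mathbf u(x)=\mu\Delta\mathbf u(x)+2\mu\nabla(\nabla\cdot\mathbf u)(x).$$
   Context: $B_\delta(0)$ is the ball of radius $\delta$ centered at the origin in $\mathbb{R}^n$, $\mu$ is a real constant (a Lamé parameter), $w\otimes w$ is the matrix $(w_iw_j)_{i,j}$, and $$c^{\delta,\beta}=\frac{2(n+2-\beta)\,\Gamma\left(\frac n2+1\right)}{\pi^{n/2}\,\delta^{n+2-\beta}} .$$ When $n+1\le\beta<n+2$ the integral is understood in the principal value sense, i.e. as $\lim_{\epsilon\to0^+}\int_{\epsilon<\|w\|<\delta}$. ($\mathcal L_b$ is the bond-based part of the linear state-based peridynamic operator.) *)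

(* Defs.v *)
From HB Require Import structures.
From mathcomp Require Import all_boot all_order all_algebra.
From mathcomp Require Import all_classical all_reals all_analysis.

Set Implicit Arguments.
Unset Strict Implicit.
Unset Printing Implicit Defensive.

Import Order.TTheory GRing.Theory Num.Theory.
Import numFieldNormedType.Exports.

Local Open Scope classical_set_scope.
Local Open Scope ring_scope.

Section lebesgue_measure_step.
Context {R : realType} {n : nat}.
Local Notation Rm := (measurableTypeR R).

Definition tuple_cons (p : Rm * n.-tuple Rm) : n.+1.-tuple Rm :=
  [the n.+1.-tuple Rm of p.1 :: p.2].

Lemma measurable_tuple_cons : measurable_fun [set: Rm * n.-tuple Rm] tuple_cons.
Proof. exact: measurable_cons. Qed.

Variable m : {sigma_finite_measure set (n.-tuple Rm) -> \bar R}.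

Definition lebesgue_step : set (n.+1.-tuple Rm) -> \bar R :=
  pushforward (@lebesgue_measure R \x m)%E tuple_cons.

HB.instance Definition _ := Measure.copy lebesgue_step
  (measure_function_pushforward__canonical__measure_function_Measure
     (@lebesgue_measure R \x m)%E measurable_tuple_cons).

Lemma lebesgue_step_sigma_finite : sigma_finite setT lebesgue_step.
Proof.
have /sigma_finiteP[F [FT ndF Foo]] := sigma_finiteT (@lebesgue_measure R).
have /sigma_finiteP[G [GT ndG Goo]] := sigma_finiteT m.
pose uncons (t : n.+1.-tuple Rm) := (tnth t ord0, [tuple of behead t]).
have muncons : measurable_fun setT uncons.
  by apply/measurable_fun_pair; [exact: measurable_tnth|exact: measurable_behead].
have unconsK : uncons \o tuple_cons = id.
  by apply/funext => -[a t]; congr pair; exact: val_inj.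
exists (fun i => uncons @^-1` (F i `*` G i)).
  apply/seteqP; split=> // t _.
  have : [set: Rm] (uncons t).1 by [].
  have : [set: n.-tuple Rm] (uncons t).2 by [].
  rewrite FT GT => -[i _ Git] [j _ Fjt].
  exists (maxn i j) => //; split.
  - by move: Fjt; exact/subsetPset/ndF/leq_maxr.
  - by move: Git; exact/subsetPset/ndG/leq_maxl.
move=> i; have [mF Fi] := Foo i; have [mG Gi] := Goo i; split.
  by rewrite -[X in measurable X]setTI; apply: muncons => //; exact: measurableX.
rewrite /lebesgue_step /pushforward -comp_preimage unconsK preimage_id.
by rewrite product_measure1E// lte_mul_pinfty// ge0_fin_numE.
Qed.

HB.instance Definition _ :=
  Measure_isSigmaFinite.Build _ _ _ lebesgue_step lebesgue_step_sigma_finite.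

End lebesgue_measure_step.

(* The Lebesgue measure on the Borel sets of R^n, points being n-tuples. *)
Fixpoint lebesgue_tuple (R : realType) (n : nat) :
    {sigma_finite_measure set (n.-tuple (measurableTypeR R)) -> \bar R} :=
  match n with
  | 0 => @dirac _ (0.-tuple (measurableTypeR R)) [tuple] R
  | n'.+1 => lebesgue_step (lebesgue_tuple R n')
  end.

Section peridynamics.
Context {R : realType} {n : nat}.
Implicit Types (x w y : 'rV[R]_n) (u : 'rV[R]_n -> 'rV[R]_n).

Definition row_of_tuple (t : n.-tuple (measurableTypeR R)) : 'rV[R]_n :=
  \row_i tnth t i.

(* Lebesgue integral over D of an R^n-valued function, entry by entry. *)
Definition rV_integral (D : set 'rV[R]_n) (f : 'rV[R]_n -> 'rV[R]_n) :
    'rV[R]_n :=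
  \row_i \int[lebesgue_tuple R n]_(t in row_of_tuple @^-1` D)
    f (row_of_tuple t) ord0 i.

(* Euler's Gamma function at z > 0. *)
Definition Gamma (z : R) : R :=
  \int[@lebesgue_measure R]_(t in `]0, +oo[) (t `^ (z - 1) * expR (- t)).

(* The library norm on 'rV[R]_n is the sup norm. *)
Definition enorm w : R := Num.sqrt (\sum_i w ord0 i ^+ 2).

Definition outer w : 'M[R]_n := \matrix_(i, j) (w ord0 i * w ord0 j).

Definition partial (i : 'I_n) (f : 'rV[R]_n -> R) : 'rV[R]_n -> R :=
  fun y => 'D_(delta_mx ord0 i) f y.

(* All partial derivatives of order at most k exist everywhere and are
   continuous. *)
Fixpoint Ck (k : nat) (f : 'rV[R]_n -> R) : Prop :=
  continuous f /\
  match k with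
  | 0 => True
  | k'.+1 => forall i : 'I_n,
      (forall y, derivable f y (delta_mx ord0 i)) /\ Ck k' (partial i f)
  end.

Definition coord_fun u (i : 'I_n) : 'rV[R]_n -> R := fun y => u y ord0 i.

Definition gradient (f : 'rV[R]_n -> R) : 'rV[R]_n -> 'rV[R]_n :=
  fun y => \row_i partial i f y.

Definition divergence u : 'rV[R]_n -> R :=
  fun y => \sum_i partial i (coord_fun u i) y.

Definition laplacian u : 'rV[R]_n -> 'rV[R]_n :=
  fun y => \row_i \sum_j partial j (partial j (coord_fun u i)) y.

Definition scaling_const (delta beta : R) : R :=
  (2 * (n%:R + 2 - beta) * Gamma (n%:R / 2 + 1)) /
  (pi `^ (n%:R / 2) * delta `^ (n%:R + 2 - beta)).

(* Vectors are rows, so the symmetric matrix [outer w] acts on the right. *)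
Definition bond_integrand (beta : R) u x w : 'rV[R]_n :=
  (enorm w `^ (beta + 2))^-1 *: ((u (x + w) - u x) *m outer w).

(* For beta >= n + 1 the integrand need not be integrable near the origin, and
   the integral is a principal value. *)
Definition bond_integral (delta beta : R) u x : 'rV[R]_n :=
  if beta < n%:R + 1 then
    rV_integral [set w | enorm w < delta] (bond_integrand beta u x)
  else
    lim (rV_integral [set w | eps < enorm w < delta] (bond_integrand beta u x)
         @[eps --> 0^'+]).

Definition bond_operator (mu delta beta : R) u x : 'rV[R]_n :=
  ((n%:R + 2) * mu * scaling_const delta beta) *: bond_integral delta beta u x.

End peridynamics.

Arguments scaling_const {R} n delta beta.

(* Main.v *)
Require Import Defs.
From HB Require Import structures.
From mathcomp Require Import all_boot all_order all_algebra.
From mathcomp Require Import all_classical all_reals all_analysis.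
From mathcomp Require Import measurable_realfun ring lra.

Import Order.TTheory GRing.Theory Num.Theory.
Import numFieldNormedType.Exports.

Local Open Scope classical_set_scope.
Local Open Scope ring_scope.

(** Expand [u (x + w) - u x] to second order in [w].  Its three parts contribute
    as follows.

    The linear part makes the integrand odd in [w], so it integrates to zero over
    every region symmetric about the origin: over the ball when
    [beta < n + 1], where this part is integrable, and over each annulus
    otherwise.  What remains is integrable on the ball for every
    [beta < n + 2], hence the principal value is an ordinary integral
    ([bond_integralE]).

    The quadratic part involves the tensor of the integrals of
    [w_i w_j w_k w_l |w| ^ (- beta - 2)].  Reflections in the coordinate
    hyperplanes kill the entries with an unpaired index, and the others make up an
    isotropic tensor ([Rintegral_monomial4]).  The scaling constant is chosen
    so that its contraction with the Hessian of [u] is exactly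
    [mu Delta u + 2 mu grad (div u)], for every [delta] and every [beta]
    ([scaling_const_radial_moment], [Rintegral_quad_part]).

    The remainder is at most [e |w| ^ 2 + K |w| ^ 3] on a given ball, for any
    [e > 0] ([taylor2_rem_le]).  After scaling, the first term contributes a
    multiple of [e] and the second at most a multiple of
    [K (n + 2 - beta) delta], so that both limits follow from a single estimate,
    [bond_operator_estimate].

    The moments are computed without polar coordinates.  If the integral of [P]
    over [q < t] is [m t ^ E], Tonelli's theorem gives
    [int P(w) (int_(t > q(w)) k(t) dt) dw = m int_(t > 0) k(t) t ^ E dt]
    ([layer_cake]).  With [q = |w| ^ 2] and [k] a truncated power this integrates
    power weights over balls; with [k(t) = exp (- t)] it identifies [m] from a
    Gaussian integral, which is a product of one-dimensional ones, and a value of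
    the Gamma function ([quartic_ball]). *)

(** * Layer-cake integration *)

Lemma measurable_set_ltr (d : measure_display) (T : measurableType d)
    (R : realType) (f g : T -> R) :
  measurable_fun setT f -> measurable_fun setT g ->
  measurable [set x | f x < g x].
Proof.
move=> mf mg; have -> : [set x | f x < g x] = (fun x => f x < g x) @^-1` [set true].
  by apply/seteqP; split => x.
by rewrite -[X in measurable X]setTI; exact: measurable_fun_ltr.
Qed.

(** Tonelli's theorem on the region [q x < t] of the product space.  It plays the
    role of integration in polar coordinates: only the growth of the integral of
    [P] over the sublevel sets of [q] matters. *)
Lemma layer_cake (d : measure_display) (T : measurableType d) (R : realType)
    (mu : {sigma_finite_measure set T -> \bar R})
    (P q : T -> R) (k : R -> R) (m : \bar R) (E : R) :
  measurable_fun setT P -> measurable_fun setT q -> measurable_fun setT k ->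
  (forall x, 0 <= P x) -> (forall x, 0 <= q x) -> (forall t, 0 <= k t) ->
  (forall t, 0 < t ->
    (\int[mu]_(x in [set x | (q x < t)%R]) (P x)%:E = m * (t `^ E)%:E)%E) ->
  (\int[mu]_x ((P x)%:E *
     \int[@lebesgue_measure R]_(t in `]q x, +oo[) (k t)%:E) =
   m * \int[@lebesgue_measure R]_(t in `]0%R, +oo[) (k t * t `^ E)%:E)%E.
Proof.
move=> mP mq mk P0 q0 k0 hP.
have m0 : (0 <= m)%E.
  have := hP 1 ltr01; rewrite powR1/= mule1 => <-.
  by apply: integral_ge0 => x _; rewrite lee_fin.
pose D : set (T * measurableTypeR R) := [set z | q z.1 < z.2].
have mD : measurable D.
  by apply: measurable_set_ltr => //; exact: measurableT_comp.
pose f (z : T * measurableTypeR R) := (P z.1 * k z.2 * \1_D z)%:E.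
have f0 z : (0 <= f z)%E by rewrite lee_fin !mulr_ge0.
have mf : measurable_fun setT f.
  apply/measurable_EFinP; apply: measurable_funM; last exact: measurable_indic.
  by apply: measurable_funM; exact: measurableT_comp.
have := @fubini_tonelli _ _ _ _ _ mu (@lebesgue_measure R) f mf f0.
rewrite /fubini_F /fubini_G /f => FT.
transitivity (\int[mu]_x \int[@lebesgue_measure R]_y (P x * k y * \1_D (x, y))%:E)%E.
  apply: eq_integral => x _.
  rewrite -ge0_integralZl//; last 3 first.
  - by apply/measurable_EFinP; exact: measurable_funTS.
  - by move=> y _; rewrite lee_fin.
  - by rewrite lee_fin.
  rewrite [LHS]integral_mkcond; apply: eq_integral => y _.
  rewrite patchE indicE /D mem_setE in_itv/= andbT.
  have -> : ((x, y) \in [set z : T * measurableTypeR R | q z.1 < z.2]) = (q x < y).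
    by apply/idP/idP; rewrite inE.
  by case: ifPn => _; rewrite ?mulr1 ?mulr0.
rewrite FT.
have mkE : measurable_fun (`]0%R, +oo[ : set R) (fun y : R => (k y * y `^ E)%:E).
  apply/measurable_EFinP; apply: measurable_funM; apply: measurable_funTS => //.
rewrite -ge0_integralZl//; last by move=> y _; rewrite lee_fin mulr_ge0// powR_ge0.
rewrite [RHS]integral_mkcond; apply: eq_integral => y _.
rewrite patchE mem_setE in_itv/= andbT.
transitivity ((k y)%:E * \int[mu]_(x in [set x | (q x < y)%R]) (P x)%:E)%E.
  rewrite -ge0_integralZl//; last 4 first.
  - exact: measurable_set_ltr.
  - by apply/measurable_EFinP; exact: measurable_funTS.
  - by move=> x _; rewrite lee_fin.
  - by rewrite lee_fin.
  rewrite [RHS]integral_mkcond; apply: eq_integral => x _.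
  rewrite patchE indicE /D.
  have -> : ((x, y) \in [set z : T * measurableTypeR R | q z.1 < z.2]) = (q x < y).
    by apply/idP/idP; rewrite inE.
  have -> : (x \in [set x | q x < y]) = (q x < y).
    by apply/idP/idP; rewrite inE.
  by case: ifPn => _; rewrite ?mulr1 ?mulr0// -EFinM mulrC.
case: ifPn => y0; first by rewrite hP// EFinM muleA muleCA muleA.
rewrite (_ : [set x | _] = set0) ?integral_set0 ?mule0//.
apply/seteqP; split=> x //= qy; apply: (negP y0).
exact: le_lt_trans (q0 x) qy.
Qed.

(** * Power and exponential integrals on the half-line *)

Lemma integral_expRN_tail (R : realType) (x : R) :
  (\int[@lebesgue_measure R]_(t in `]x, +oo[) (expR (- t))%:E = (expR (- x))%:E)%E.
Proof.
have cexpN : continuous (fun t : R => expR (- t)).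
  by move=> t; apply: continuous_comp; [exact: opp_continuous|exact: continuous_expR].
have dexpN (t : R) : is_derive t 1 (fun t : R => - expR (- t)) (expR (- t)).
  have -> : expR (- t) = - (expR (- t) * (- 1)) :> R by rewrite mulrN1 opprK.
  exact: is_deriveN.
rewrite integral_itv_obnd_cbnd; last first.
  apply/measurable_funTS/measurable_EFinP.
  exact: continuous_measurable_fun.
rewrite (@ge0_continuous_FTC2y _ _ (fun t => - expR (- t)) _ 0).
- by rewrite -EFinB sub0r opprK.
- by move=> t _; exact: expR_ge0.
- exact: continuous_subspaceT.
- rewrite -[X in _ --> X]oppr0; apply: cvgN.
  exact: cvgr_expR.
- by move=> t _; have [] := dexpN t.
- by apply: cvgN; apply: cvg_at_right_filter; exact: cexpN.
- move=> t _; rewrite derive1E; exact: derive_val.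
Qed.

Lemma integral_powR_itv (R : realType) (x D s : R) : 0 < x -> x < D -> s != 0 ->
  (\int[@lebesgue_measure R]_(t in `]x, D[) (t `^ (s - 1))%:E =
    ((D `^ s - x `^ s) / s)%:E)%E.
Proof.
move=> x0 xD s0.
have c0 (t r : R) : 0 < t -> {for t, continuous (fun u : R => u `^ r)}.
  move=> t0; apply: differentiable_continuous; apply/derivable1_diffP.
  by have [] := is_derive1_powR r t0.
rewrite integral_itv_bndo_bndc; last exact/measurable_funTS/measurable_EFinP.
rewrite integral_itv_obnd_cbnd; last exact/measurable_funTS/measurable_EFinP.
rewrite (@continuous_FTC2 _ _ (fun t => s^-1 * t `^ s)).
- by rewrite -EFinB -mulrBr mulrC.
- exact: xD.
- apply: continuous_in_subspaceT => t; rewrite inE/= in_itv/= => /andP[xt _].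
  by apply: c0; exact: lt_le_trans xt.
- split.
  + move=> t; rewrite in_itv/= => /andP[xt _].
    apply: derivableM => //; have [] := is_derive1_powR s (lt_trans x0 xt) => //.
  + apply: cvgM; first exact: cvg_cst. apply: cvg_at_right_filter.
    exact: c0.
  + apply: cvgM; first exact: cvg_cst. apply: cvg_at_left_filter.
    by apply: c0; exact: lt_trans xD.
- move=> t; rewrite in_itv/= => /andP[xt _]; have t0 := lt_trans x0 xt.
  have := is_derive1_powR s t0; move=> H.
  by rewrite derive1E derive_val /GRing.scale/= mulrA mulVf// mul1r.
Qed.

(** For [e < 1] the integrand is unbounded at [0]; exhaust the interval by
    [`]D / (n + 2), D[]. *)
Lemma integral_powR_itv0 (R : realType) (D e : R) : 0 < D -> 0 < e ->
  (\int[@lebesgue_measure R]_(t in `]0%R, D[) (t `^ (e - 1))%:E = (D `^ e / e)%:E)%E.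
Proof.
move=> D0 e0.
pose x_ (n : nat) : R := D / n.+2%:R.
have x_gt0 n : 0 < x_ n by rewrite divr_gt0.
have x_ltD n : x_ n < D by rewrite /x_ ltr_pdivrMr// ltr_pMr// ltr1n.
have x_cvg : x_ n @[n --> \oo] --> 0.
  rewrite -[X in _ --> X](mulr0 D); apply: cvgM; first exact: cvg_cst.
  by have := @cvg_harmonic R; rewrite -cvg_shiftS.
have U : (\bigcup_n [set` `]x_ n, D[]) = [set` `]0, D[] :> set R.
  apply/seteqP; split => [t [n _]|t]; rewrite /= !in_itv/=.
    by move=> /andP[xt ->]; rewrite (lt_trans (x_gt0 n) xt).
  move=> /andP[t0 tD].
  have /cvgr0Pnorm_lt/(_ t t0)[N _ /(_ N (leqnn _))] := x_cvg.
  by rewrite /= gtr0_norm// => xt; exists N => //=; rewrite in_itv/= xt.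
have := @ge0_nondecreasing_set_cvg_integral _ (measurableTypeR R) R
  (fun n => [set` `]x_ n, D[] : set (measurableTypeR R)) (fun t => (t `^ (e - 1))%:E) (@lebesgue_measure R).
rewrite U => /(_ _ _ _ _)/cvg_lim <-//; last 3 first.
- apply/nondecreasing_seqP => n; rewrite subsetEset; apply: subset_itvr.
  by rewrite bnd_simp /x_ ler_pM2l// lef_pV2 ?posrE// ler_nat.
- by move=> n; apply/measurable_funTS/measurable_EFinP.
- by move=> n t _; rewrite lee_fin powR_ge0.
under eq_fun do rewrite integral_powR_itv ?gt_eqF//.
apply/cvg_lim => //.
apply: cvg_EFin; first by near=> n.
rewrite -[D `^ e in X in _ --> X]subr0; apply: cvgM; last exact: cvg_cst.
apply: cvgB; first exact: cvg_cst.
apply: cvg_comp (powR_cvg0 e0) => A A0.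
by have [N _ NA] := x_cvg _ A0; exists N => // n Nn; exact: NA n Nn (x_gt0 n).
Unshelve. all: by end_near. Qed.

(** * Radial power weights *)

Lemma integrable_scale (d : measure_display) (T : measurableType d)
    (R : realType) (mu : {measure set T -> \bar R}) (D : set T) (f : T -> R)
    (k : R) :
  measurable D -> mu.-integrable D (EFin \o f) ->
  mu.-integrable D (EFin \o (fun x => k * f x)).
Proof. by move=> mD fi; exact: (integrableZl mD k fi). Qed.

Section radial_power.
Context (d : measure_display) (T : measurableType d) (R : realType)
  (mu : {sigma_finite_measure set T -> \bar R}).
Variables (P q : T -> R) (c E : R).
Hypotheses (mP : measurable_fun setT P) (mq : measurable_fun setT q).
Hypotheses (P0 : forall x, 0 <= P x) (q0 : forall x, 0 <= q x).
Hypothesis Pq0 : forall x, q x = 0 -> P x = 0.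
Hypothesis hP : forall t : R, 0 < t ->
  (\int[mu]_(x in [set x | (q x < t)%R]) (P x)%:E = (c * t `^ E)%:E)%E.

Let mB D : measurable [set x | q x < D].
Proof. exact: measurable_set_ltr. Qed.

(** The layer-cake formula for [k t = t ^ (s - 1)] cut off at [D]: the tail
    integral of [k] is [(D ^ s - q ^ s) / s], which is nonnegative whatever the
    sign of [s]. *)
Lemma integral_tail (D s : R) : 0 < D -> s != 0 -> 0 < E + s ->
  (\int[mu]_(x in [set x | (q x < D)%R]) (P x * ((D `^ s - q x `^ s) / s))%:E
   = (c * (D `^ (E + s) / (E + s)))%:E)%E.
Proof.
move=> D0 s0 Es0.
pose k (t : R) := t `^ (s - 1) * \1_(`]-oo, D[%classic : set R) t.
have mk : measurable_fun setT k.
  by apply: measurable_funM => //; exact: measurable_indic.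
have k0 t : 0 <= k t by rewrite mulr_ge0 ?powR_ge0.
have intk (x : R) (g : R -> R) :
   (\int[@lebesgue_measure R]_(t in `]x, +oo[) (k t * g t)%:E =
   \int[@lebesgue_measure R]_(t in `]x, D[) (t `^ (s - 1) * g t)%:E)%E.
  rewrite integral_mkcond [RHS]integral_mkcond; apply: eq_integral => t _.
  rewrite !patchE !mem_setE !in_itv/= andbT /k indicE mem_setE in_itv/=.
  by case: ifPn => //= _; case: ifPn => //= _; rewrite ?mulr1// mulr0 mul0r.
have := @layer_cake _ _ _ mu P q k c%:E E mP mq mk P0 q0 k0.
rewrite intk.
have -> : (\int[@lebesgue_measure R]_(t in `]0%R, D[) (t `^ (s - 1) * t `^ E)%:E =
    (D `^ (E + s) / (E + s))%:E)%E.
  rewrite -integral_powR_itv0//; apply: eq_integral => t.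
  rewrite inE/= in_itv/= => /andP[t0 _].
  rewrite -powRD; last by rewrite (gt_eqF t0) implybT.
  by rewrite addrAC (addrC s).
rewrite -EFinM => <-; last by move=> t t0; rewrite hP// EFinM.
rewrite integral_mkcond; apply: eq_integral => x _.
rewrite patchE.
have -> : (x \in [set x | q x < D]) = (q x < D) by apply/idP/idP; rewrite inE.
have := intk (q x) (cst 1).
under eq_integral do rewrite mulr1.
move=> ->.
under eq_integral do rewrite mulr1.
case: ltP => qD; last first.
  have -> : `]q x, D[%classic = set0 :> set R by rewrite set_itv_ge// bnd_simp -leNgt.
  by rewrite integral_set0 mule0.
have [qx0|qx0] := eqVneq (q x) 0; first by rewrite Pq0// mul0r mul0e.
by rewrite integral_powR_itv// lt0r qx0 q0.
Qed.

Lemma ge0_integrable_EFin (f : T -> R) (D : set T) (r : R) : measurable D ->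
  measurable_fun setT f -> (forall x, D x -> 0 <= f x) ->
  (\int[mu]_(x in D) (f x)%:E = r%:E)%E -> mu.-integrable D (EFin \o f).
Proof.
move=> mD mf f0 fr; apply/integrableP; split.
  by apply/measurable_EFinP; exact: measurable_funTS.
rewrite (eq_integral (fun x => (f x)%:E)) ?fr ?ltry// => x /[!inE] Dx /=.
by rewrite ger0_norm// f0.
Qed.

(** Write [q ^ s] as [D ^ s - s ((D ^ s - q ^ s) / s)] and integrate both terms.
    The condition [0 < E + s] is what makes [P q ^ s] integrable where [q] is
    close to [0]. *)
Lemma integral_radial_power (D s : R) : 0 < D -> 0 < E + s -> 0 < E ->
  (\int[mu]_(x in [set x | (q x < D)%R]) (P x * q x `^ s)%:E
   = (c * (E / (E + s)) * D `^ (E + s))%:E)%E.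
Proof.
move=> D0 Es0 E0.
have [->|s0] := eqVneq s 0.
  under eq_integral do rewrite powRr0 mulr1.
  by rewrite hP// addr0 divff ?gt_eqF// mulr1.
pose f1 x := D `^ s * P x.
pose f2 x := s * (P x * ((D `^ s - q x `^ s) / s)).
have f12 x : P x * q x `^ s = f1 x - f2 x.
  by rewrite /f1 /f2; field.
have mtail : measurable_fun setT (fun x => P x * ((D `^ s - q x `^ s) / s)).
  apply: measurable_funM => //; apply: measurable_funM => //.
  apply: measurable_funB => //.
  exact: (measurableT_comp (measurable_powR _) mq).
have itail : mu.-integrable [set x | q x < D]
    (EFin \o (fun x => P x * ((D `^ s - q x `^ s) / s))).
  apply: (@ge0_integrable_EFin _ _ _ (mB D) mtail); last exact: integral_tail.
  move=> x /= qD; have [qx0|qx0] := eqVneq (q x) 0; first by rewrite Pq0// mul0r.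
  have qx_gt0 : 0 < q x by rewrite lt0r qx0 q0.
  by rewrite mulr_ge0// -lee_fin -integral_powR_itv//;
    apply: integral_ge0 => t _; rewrite lee_fin powR_ge0.
have iP : mu.-integrable [set x | q x < D] (EFin \o P).
  by apply: (@ge0_integrable_EFin P _ (c * D `^ E)) => //; exact: hP.
under eq_integral do rewrite f12.
rewrite integralB_EFin//; last 2 first.
- exact: integrable_scale.
- exact: integrable_scale.
rewrite /f1 /f2; under eq_integral do rewrite EFinM.
rewrite integralZl// hP//.
under [X in (_ - X)%E]eq_integral do rewrite EFinM.
rewrite integralZl// integral_tail// -!EFinM -EFinB; congr EFin.
rewrite powRD; last by rewrite (gt_eqF D0) implybT.
by field; rewrite gt_eqF.
Qed.

End radial_power.

(** * The Gamma function and Gaussian moments *)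

Section gamma.
Context {R : realType}.
Implicit Types (z t : R).
Local Notation leb := (@lebesgue_measure R).

(** The extended-real Gamma integral; its finiteness is read off later from the
    value of a Gaussian integral. *)
Definition gammae z : \bar R :=
  (\int[leb]_(t in `]0%R, +oo[) (t `^ (z - 1) * expR (- t))%:E)%E.

Lemma gammae_ge0 z : (0 <= gammae z)%E.
Proof.
by apply: integral_ge0 => t _; rewrite lee_fin mulr_ge0 ?powR_ge0 ?expR_ge0.
Qed.

Lemma Gamma_gammae z : Gamma z = fine (gammae z).
Proof. by []. Qed.

Lemma measurable_expRN : measurable_fun setT (fun t : R => expR (- t)).
Proof. by apply: measurableT_comp => //; exact: measurable_funN. Qed.

(** The layer-cake formula for [k t = exp (- t)], which is its own tail
    integral. *)
Lemma integral_expRN_radial (d : measure_display) (T : measurableType d)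
    (mu : {sigma_finite_measure set T -> \bar R})
    (P q : T -> R) (m : \bar R) (E : R) :
  measurable_fun setT P -> measurable_fun setT q ->
  (forall x, 0 <= P x) -> (forall x, 0 <= q x) ->
  (forall t, 0 < t ->
    (\int[mu]_(x in [set x | (q x < t)%R]) (P x)%:E = m * (t `^ E)%:E)%E) ->
  (\int[mu]_x (P x * expR (- q x))%:E = m * gammae (E + 1))%E.
Proof.
move=> mP mq P0 q0 hP.
have := @layer_cake _ _ _ mu P q (fun t => expR (- t)) m E mP mq
  measurable_expRN P0 q0 (fun t => expR_ge0 _) hP.
under eq_integral do rewrite integral_expRN_tail -EFinM.
move=> ->; congr (_ * _)%E; apply: eq_integral => t _.
by rewrite mulrC addrK.
Qed.

(** The layer-cake formula on the line, for [P t = z t ^ (z - 1)] on [t > 0]: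
    its integral up to [t] is [t ^ z]. *)
Lemma gammaeD1 z : 0 < z -> (gammae (z + 1) = z%:E * gammae z)%E.
Proof.
move=> z0.
(* The cut-off matters: a negative number to any power is 1 here. *)
pose P (t : R) := z * (t `^ (z - 1) * \1_(`]0, +oo[%classic : set R) t).
have mP : measurable_fun setT P.
  by apply: measurable_funM => //; apply: measurable_funM.
have P0 t : 0 <= P t by rewrite !mulr_ge0 ?powR_ge0// ltW.
have mq : measurable_fun setT (fun t : R => `|t|) by exact: normr_measurable.
have hP (t : R) : 0 < t ->
    (\int[leb]_(x in [set x | (`|x| < t)%R]) (P x)%:E = 1%:E * (t `^ z)%:E)%E.
  move=> t0; rewrite mul1e.
  transitivity (\int[leb]_(x in `]0%R, t[) (z%:E * (x `^ (z - 1))%:E))%E.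
    rewrite integral_mkcond [RHS]integral_mkcond; apply: eq_integral => x _.
    rewrite !patchE.
    have -> : (x \in [set x | `|x| < t]) = (`|x| < t) by apply/idP/idP; rewrite inE.
    rewrite /P indicE !mem_setE !in_itv/= andbT.
    case: (ltP 0 x) => /= x0; last by rewrite !mulr0 if_same.
    by rewrite gtr0_norm// mulr1 EFinM.
  rewrite ge0_integralZl//; last 3 first.
  - exact/measurable_funTS/measurable_EFinP.
  - by move=> x _; rewrite lee_fin powR_ge0.
  - by rewrite lee_fin ltW.
  by rewrite integral_powR_itv0// -EFinM mulrC divfK// gt_eqF.
rewrite -[LHS]mul1e -(@integral_expRN_radial _ _ leb P _ 1%E z mP mq P0 _ hP)//.
rewrite /gammae -ge0_integralZl//; last 3 first.
- apply/measurable_EFinP/measurable_funTS/measurable_funM => //.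
  exact: measurable_expRN.
- by move=> t _; rewrite lee_fin mulr_ge0 ?powR_ge0 ?expR_ge0.
- by rewrite lee_fin ltW.
rewrite [RHS]integral_mkcond; apply: eq_integral => t _.
rewrite patchE /P indicE !mem_setE !in_itv/= andbT.
case: ltP => t0 /=; last by rewrite !mulr0 mul0r.
by rewrite mulr1 -EFinM gtr0_norm// mulrA.
Qed.

Lemma integral_exprn_sublevel (m : nat) t : 0 < t ->
  (\int[leb]_(x in [set x | (x ^+ 2 < t)%R]) (x ^+ m.*2)%:E =
   (2 / m.*2.+1%:R)%:E * (t `^ (m%:R + 2^-1))%:E)%E.
Proof.
move=> t0; pose a := Num.sqrt t.
have a0 : 0 < a by rewrite sqrtr_gt0.
have Na : - a < a by rewrite gtrN.
have -> : [set x : R | x ^+ 2 < t] = `]-a, a[%classic.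
  apply/seteqP; split => x /=; rewrite in_itv/= -ltr_norml.
    by move=> xt; rewrite -sqrtr_sqr ltr_sqrt.
  by move=> xa; rewrite -(sqr_sqrtr (ltW t0)) -real_normK ?num_real// ltr_pXn2r// nnegrE// ltW.
have cX (k : nat) : continuous (fun x : R => x ^+ k) by exact: exprn_continuous.
rewrite integral_itv_bndo_bndc; last exact/measurable_funTS/measurable_EFinP/measurable_funX.
rewrite integral_itv_obnd_cbnd; last exact/measurable_funTS/measurable_EFinP/measurable_funX.
have dX (x : R) : derivable (fun x : R => m.*2.+1%:R^-1 * x ^+ m.*2.+1) x 1.
  by apply: derivableM; [exact: derivable_cst|exact: exprn_derivable].
rewrite (@continuous_FTC2 _ _ (fun x => m.*2.+1%:R^-1 * x ^+ m.*2.+1))//.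
- rewrite -EFinB -EFinM; congr EFin.
  have -> : t `^ (m%:R + 2^-1) = a ^+ m.*2.+1.
    rewrite powRD; last by rewrite (gt_eqF t0) implybT.
    rewrite powR12_sqrt ?(ltW t0)// powR_mulrn ?(ltW t0)// exprSr -muln2 mulnC exprM.
    by rewrite sqr_sqrtr// ltW.
  have -> : (- a) ^+ m.*2.+1 = - a ^+ m.*2.+1.
    by rewrite exprNn -signr_odd/= odd_double/= mulN1r.
  by ring.
- by apply: continuous_subspaceT.
- split; first by move=> x _; exact: dX.
  + by apply: cvgM; [exact: cvg_cst|apply: cvg_at_right_filter; exact: cX].
  + by apply: cvgM; [exact: cvg_cst|apply: cvg_at_left_filter; exact: cX].
- move=> x _; rewrite derive1E.
  rewrite (@deriveM _ _ (cst m.*2.+1%:R^-1) (fun x : R => x ^+ m.*2.+1)); last 2 first.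
  + exact: derivable_cst.
  + exact: exprn_derivable.
  rewrite derive_cst scaler0 addr0 exp_derive /GRing.scale/= mulr1.
  by rewrite mulrA mulVf// mul1r.
Qed.

Definition gauss_moment (m : nat) : \bar R :=
  (\int[leb]_x (x ^+ m.*2 * expR (- x ^+ 2))%:E)%E.

Lemma gauss_momentE (m : nat) :
  (gauss_moment m = (2 / m.*2.+1%:R)%:E * gammae (m%:R + 2^-1 + 1))%E.
Proof.
apply: (@integral_expRN_radial _ _ leb (fun x : R => x ^+ m.*2)
  (fun x => x ^+ 2)) => //.
- by move=> x; rewrite -muln2 mulnC exprM exprn_ge0// sqr_ge0.
- by move=> x; exact: sqr_ge0.
- exact: integral_exprn_sublevel.
Qed.

Lemma gauss_moment0 : gauss_moment 0 = (Num.sqrt pi)%:E.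
Proof.
rewrite -integralT_gauss; apply: eq_integral => x _.
by rewrite expr0 mul1r.
Qed.

(** By [gauss_momentE] every moment is a value of the Gamma function, so the
    functional equation of Gamma relates consecutive moments. *)
Lemma gauss_momentS (m : nat) :
  (gauss_moment m.+1 = (m.*2.+1%:R / 2)%:E * gauss_moment m)%E.
Proof.
rewrite !gauss_momentE gammaeD1; last by rewrite ltr_wpDr// ?ltr0n.
rewrite addrAC natr1 !muleA -!EFinM; congr (_%:E * gammae _)%E.
have -> : m.+1.*2.+1%:R = m.+1%:R * 2 + 1 :> R by rewrite -addn1 natrD -muln2 natrM.
have -> : m.*2.+1%:R = m%:R * 2 + 1 :> R by rewrite -addn1 natrD -muln2 natrM.
have m0 : 0 <= m%:R :> R by [].
by rewrite -natr1; field; apply/andP; split; rewrite gt_eqF//; lra.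
Qed.

End gamma.

(** * Lebesgue measure on tuples *)

Lemma lebesgue_measure_dilation (R : realType) (a : R) (A : set (measurableTypeR R)) :
  a != 0 -> measurable A ->
  (@lebesgue_measure R A =
   `|a|%:E * @lebesgue_measure R ((fun x : R => (a * x)%R) @^-1` A))%E.
Proof.
move=> a0 mA.
have ma : measurable_fun [set: measurableTypeR R]
  (fun x : measurableTypeR R => (a * x : measurableTypeR R)).
  exact: measurable_funM.
(* Both sides are measures in [A]; they agree on half-open intervals. *)
pose mu := mscale (NngNum (normr_ge0 a))
  (measure_function_pushforward__canonical__measure_function_Measure
     (@lebesgue_measure R) ma).
suff H : forall X, ocitv X -> lebesgue_measure X = mu X by exact: (@lebesgue_measure_unique R mu H A mA).
move=> _ [[x y] _ <-].
rewrite /mu /mscale/= /pushforward.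
have [xy|yx] := ltP x y; last first.
  rewrite /= set_itv_ge ?bnd_simp -?leNgt//.
  by rewrite !measure0 mule0.
have [a_lt0|a_gt0|a_eq0] := ltgtP a 0; last by rewrite a_eq0 eqxx in a0.
- have -> : (fun t : R => a * t) @^-1` `]x, y] = `[y / a, x / a[%classic.
    apply/seteqP; split => t /=; rewrite !in_itv/= => /andP[].
      by rewrite ler_ndivrMr// ltr_ndivlMr// ![a * t]mulrC => -> ->.
    by rewrite ler_ndivrMr// ltr_ndivlMr// ![t * a]mulrC => -> ->.
  rewrite !lebesgue_measure_itv/= !lte_fin xy ltr_nM2r ?invr_lt0// xy.
  by rewrite ltr0_norm// -!EFinD -EFinM; congr EFin; field.
- have -> : (fun t : R => a * t) @^-1` `]x, y] = `]x / a, y / a]%classic.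
    apply/seteqP; split => t /=; rewrite !in_itv/= => /andP[].
      by rewrite ler_pdivlMr// ltr_pdivrMr// ![a * t]mulrC => -> ->.
    by rewrite ler_pdivlMr// ltr_pdivrMr// ![t * a]mulrC => -> ->.
  rewrite !lebesgue_measure_itv/= !lte_fin xy ltr_pM2r ?invr_gt0// xy.
  by rewrite gtr0_norm// -!EFinD -EFinM; congr EFin; field.
Qed.

Lemma ge0_integral_dilation (R : realType) (a : R)
    (g : measurableTypeR R -> \bar R) :
  a != 0 -> measurable_fun setT g -> (forall x, 0 <= g x)%E ->
  (\int[@lebesgue_measure R]_x g (a * x)%R =
   `|a|^-1%:E * \int[@lebesgue_measure R]_x g x)%E.
Proof.
move=> a0 mg g0.
have ma : measurable_fun [set: measurableTypeR R]
  (fun x : measurableTypeR R => (a * x : measurableTypeR R)).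
  exact: measurable_funM.
pose mu := mscale (NngNum (normr_ge0 a))
  (measure_function_pushforward__canonical__measure_function_Measure
     (@lebesgue_measure R) ma).
have -> : (\int[@lebesgue_measure R]_x g x = \int[mu]_x g x)%E.
  by apply: eq_measure_integral => A mA _; exact: lebesgue_measure_dilation.
rewrite ge0_integral_mscale// ge0_integral_pushforward//.
by rewrite muleA -EFinM/= mulVf ?normr_eq0// mul1e.
Qed.

Section lebesgue_tuple.
Context {R : realType}.
Local Notation Rm := (measurableTypeR R).
Local Notation leb := (@lebesgue_measure R).
Local Notation lebn n := (lebesgue_tuple R n).
Local Open Scope ereal_scope.

Lemma measurable_comp_tuple_cons n (f : n.+1.-tuple Rm -> \bar R) :
  measurable_fun setT f -> measurable_fun setT (f \o tuple_cons).
Proof. move=> mf; apply: measurableT_comp => //; exact: measurable_tuple_cons. Qed.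

Lemma measurable_tuple_cons_section n (f : n.+1.-tuple Rm -> \bar R) (x : Rm) :
  measurable_fun setT f ->
  measurable_fun setT (fun t : n.-tuple Rm => f (tuple_cons (x, t))).
Proof.
move=> mf; apply: (measurableT_comp mf).
exact: (@measurable_cons _ _ _ _ (cst x) n id).
Qed.

Lemma ge0_integral_tuple_cons n (f : n.+1.-tuple Rm -> \bar R) :
  measurable_fun setT f -> (forall t, 0 <= f t) ->
  \int[lebn n.+1]_t f t = \int[leb]_x \int[lebn n]_t f (tuple_cons (x, t)).
Proof.
move=> mf f0.
transitivity (\int[pushforward (leb \x lebn n) (@tuple_cons R n)]_t f t) => //.
rewrite ge0_integral_pushforward//; last exact: measurable_tuple_cons.
rewrite preimage_setT fubini_tonelli1//.
  exact: measurable_comp_tuple_cons.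
by move=> z; exact: f0.
Qed.

Lemma integral_tuple0 (f : 0.-tuple Rm -> \bar R) :
  \int[lebn 0]_t f t = f [tuple].
Proof.
rewrite (eq_integral (cst (f [tuple]))); last by move=> t _; rewrite (tuple0 t).
by rewrite integral_cst//= diracT mule1.
Qed.

Lemma measurable_integral_tuple_cons n (f : n.+1.-tuple Rm -> \bar R) :
  measurable_fun setT f -> (forall t, 0 <= f t) ->
  measurable_fun setT (fun x : Rm => \int[lebn n]_t f (tuple_cons (x, t))).
Proof.
move=> mf f0.
apply: (@measurable_fun_fubini_tonelli_F _ _ _ _ _ (lebn n) (f \o tuple_cons)).
  exact: measurable_comp_tuple_cons.
by move=> z; exact: f0.
Qed.

Definition tuple_dilation {n : nat} (a : 'I_n -> R) (t : n.-tuple Rm) : n.-tuple Rm :=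
  [tuple (a i * tnth t i)%R | i < n].

Lemma measurable_tuple_dilation n (a : 'I_n -> R) :
  measurable_fun setT (tuple_dilation a).
Proof.
apply/measurable_fun_tnthP => i.
rewrite (_ : _ \o _ = fun t : n.-tuple Rm => (a i * tnth t i)%R); last first.
  by apply/funext => t /=; rewrite tnth_mktuple.
by apply: measurable_funM => //; exact: measurable_tnth.
Qed.

Lemma tuple_dilation_cons n (a : 'I_n.+1 -> R) (x : Rm) (t : n.-tuple Rm) :
  tuple_dilation a (tuple_cons (x, t)) =
  tuple_cons ((a ord0 * x)%R, tuple_dilation (a \o lift ord0) t).
Proof.
apply: eq_from_tnth => i; rewrite tnth_mktuple.
case: (unliftP ord0 i) => [j|] ->; last by rewrite !tnth0.
by rewrite !tnthS tnth_mktuple.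
Qed.

(** Covers both uses of the symmetries of Lebesgue measure: uniform scaling
    ([a] a positive constant) and coordinate reflections ([a i = 1] or [-1]). *)
Lemma ge0_integral_tuple_dilation n (a : 'I_n -> R) (f : n.-tuple Rm -> \bar R) :
  (forall i, a i != 0)%R -> measurable_fun setT f -> (forall t, 0 <= f t) ->
  \int[lebn n]_t f (tuple_dilation a t) =
  (\prod_i `|a i|^-1)%:E * \int[lebn n]_t f t.
Proof.
elim: n a f => [|n IH] a f a0 mf f0.
  by rewrite !integral_tuple0 big_ord0 mul1e tuple0.
have mfa : measurable_fun setT (f \o tuple_dilation a).
  by apply: measurableT_comp => //; exact: measurable_tuple_dilation.
rewrite ge0_integral_tuple_cons// ge0_integral_tuple_cons//.
pose g x := \int[lebn n]_t f (tuple_cons (x, t)).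
have mg : measurable_fun setT g by exact: measurable_integral_tuple_cons.
have g0 x : 0 <= g x by apply: integral_ge0.
under eq_integral => x _.
  under eq_integral do rewrite tuple_dilation_cons.
  rewrite (IH (a \o lift ord0) (fun t => f (tuple_cons ((a ord0 * x)%R, t))))//; last 2 first.
  - by move=> i /=; exact: a0.
  - exact: measurable_tuple_cons_section.
  rewrite -/(g _).
over.
rewrite ge0_integralZl; last 4 first.
- exact: measurableT.
- by apply: (measurableT_comp mg); exact: measurable_funM.
- by move=> x _; exact: g0.
- by rewrite lee_fin prodr_ge0.
by rewrite ge0_integral_dilation// muleA -EFinM big_ord_recl [in RHS]mulrC.
Qed.

Lemma integral_tuple_prod n (g : 'I_n -> R -> R) (c : 'I_n -> R) :
  (forall i, measurable_fun setT (g i)) -> (forall i x, 0 <= g i x)%R ->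
  (forall i, \int[leb]_x (g i x)%:E = (c i)%:E) ->
  \int[lebn n]_t (\prod_i g i (tnth t i))%:E = (\prod_i c i)%:E.
Proof.
elim: n g c => [|n IH] g c mg g0 gc.
  by rewrite integral_tuple0 !big_ord0.
have mprod k (h : 'I_k -> R -> R) : (forall i, measurable_fun setT (h i)) ->
    measurable_fun setT (fun t : k.-tuple Rm => (\prod_i h i (tnth t i))%:E).
  move=> mh; apply/measurable_EFinP; apply: measurable_prod => i _.
  by apply: (measurableT_comp (mh i)); exact: measurable_tnth.
rewrite ge0_integral_tuple_cons; last 2 first.
- exact: mprod.
- by move=> t; rewrite lee_fin prodr_ge0.
transitivity (\int[leb]_x ((g ord0 x)%:E * (\prod_i c (lift ord0 i))%:E)).
  apply: eq_integral => x _.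
  rewrite -(IH (fun i => g (lift ord0 i)))// -ge0_integralZl//; last 3 first.
  - exact: (mprod _ (fun i => g (lift ord0 i))).
  - by move=> t _; rewrite lee_fin prodr_ge0.
  - by rewrite lee_fin.
  apply: eq_integral => t _; rewrite big_ord_recl EFinM tnth0.
  by congr (_ * _%:E); apply: eq_bigr => i _; rewrite tnthS.
rewrite ge0_integralZr//; last 3 first.
- by apply/measurable_EFinP; exact: mg.
- by move=> x _; rewrite lee_fin.
- rewrite lee_fin prodr_ge0// => i _; rewrite -lee_fin -gc.
  by apply: integral_ge0 => x _; rewrite lee_fin.
by rewrite gc -EFinM big_ord_recl.
Qed.

End lebesgue_tuple.

(** * Fourth-order moments of balls *)

Section ball_moments.
Context {R : realType} {n : nat}.
Local Notation Rm := (measurableTypeR R).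
Local Notation lebn := (lebesgue_tuple R n).
Implicit Types (t : n.-tuple Rm) (i j k : 'I_n).

Definition sqnorm t : R := \sum_i tnth t i ^+ 2.

Lemma sqnorm_ge0 t : 0 <= sqnorm t.
Proof. by apply: sumr_ge0 => i _; exact: sqr_ge0. Qed.

Lemma measurable_tnth_real i : measurable_fun setT (fun t => tnth t i : R).
Proof. exact: measurable_tnth. Qed.

Lemma measurable_sqnorm : measurable_fun setT sqnorm.
Proof.
apply: measurable_sum => i; apply: measurable_funX; exact: measurable_tnth_real.
Qed.

Lemma measurable_sqnorm_ball r : measurable [set t | sqnorm t < r].
Proof. by apply: measurable_set_ltr => //; exact: measurable_sqnorm. Qed.

Lemma ge0_integral_ball_homogeneous (P : n.-tuple Rm -> R) (p : nat) (r : R) :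
  measurable_fun setT P -> (forall t, 0 <= P t) ->
  (forall a t, 0 < a -> P (tuple_dilation (fun=> a) t) = a ^+ p * P t) ->
  0 < r ->
  (\int[lebn]_(t in [set t | (sqnorm t < r)%R]) (P t)%:E =
   (\int[lebn]_(t in [set t | (sqnorm t < 1)%R]) (P t)%:E) *
   (r `^ ((n%:R + p%:R) / 2))%:E)%E.
Proof.
move=> mP P0 Pa r0; pose a := Num.sqrt r.
have a0 : 0 < a by rewrite sqrtr_gt0.
have memB s t : (t \in [set t | sqnorm t < s]) = (sqnorm t < s).
  by apply/idP/idP; rewrite inE.
pose f t := ((fun t => (P t)%:E) \_ [set t | (sqnorm t < r)%R]) t.
have f0 t : (0 <= f t)%E by rewrite /f patchE; case: ifPn => // _; rewrite lee_fin.
have mf : measurable_fun setT f.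
  apply/(measurable_restrictT _ _).1; first exact: measurable_sqnorm_ball.
  by apply/measurable_EFinP; exact: measurable_funTS.
have := @ge0_integral_tuple_dilation R n (fun=> a) f (fun=> lt0r_neq0 a0) mf f0.
have qa t : sqnorm (tuple_dilation (fun=> a) t) = r * sqnorm t.
  rewrite /sqnorm mulr_sumr; apply: eq_bigr => i _.
  by rewrite tnth_mktuple exprMn sqr_sqrtr// ltW.
have -> : (\int[lebn]_t f (tuple_dilation (fun=> a) t) = (a ^+ p)%:E *
    \int[lebn]_(t in [set t | (sqnorm t < 1)%R]) (P t)%:E)%E.
  rewrite -ge0_integralZl; last 4 first.
  - exact: measurable_sqnorm_ball.
  - by apply/measurable_EFinP; exact: measurable_funTS.
  - by move=> t _; rewrite lee_fin.
  - by rewrite lee_fin exprn_ge0// ltW.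
  rewrite [RHS]integral_mkcond; apply: eq_integral => t _.
  rewrite /f !patchE !memB qa gtr_pMr//.
  by case: ifPn => // _; rewrite Pa.
rewrite prodr_const card_ord gtr0_norm// => H.
rewrite integral_mkcond -/f muleC.
have -> : r `^ ((n%:R + p%:R) / 2) = a ^+ n * a ^+ p.
  rewrite -natrD [_ / 2]mulrC powRrM powR12_sqrt ?(ltW r0)// -/a.
  by rewrite powR_mulrn ?(ltW a0)// exprD.
by rewrite EFinM -muleA H muleA -EFinM exprVn mulfV ?mul1e// expf_neq0 ?gt_eqF.
Qed.

Definition quartic i j t : R := tnth t i ^+ 2 * tnth t j ^+ 2.

Lemma quartic_ge0 i j t : 0 <= quartic i j t.
Proof. by rewrite mulr_ge0 ?sqr_ge0. Qed.

Lemma measurable_quartic i j : measurable_fun setT (quartic i j).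
Proof.
by apply: measurable_funM; apply: measurable_funX; exact: measurable_tnth_real.
Qed.

Let gauss_ratio (e : nat) : R := nth 0 [:: 1; 2^-1; 3 / 4] e.

Let gauss_moment_le2 (e : nat) : (e <= 2)%N ->
  gauss_moment e = (Num.sqrt pi * gauss_ratio e)%:E.
Proof.
case: e => [|[|[|//]]] _; rewrite /gauss_ratio/=.
- by rewrite gauss_moment0 mulr1.
- rewrite gauss_momentS gauss_moment0 -EFinM; congr EFin.
  by rewrite (_ : 0.*2.+1%:R = 1)//; field.
- rewrite !gauss_momentS gauss_moment0 -!EFinM; congr EFin.
  by rewrite (_ : 0.*2.+1%:R = 1)// (_ : 1.*2.+1%:R = 3)//; field.
Qed.

(** Separation of variables: the coordinate [k] carries the exponent
    [2 ((k == i) + (k == j))], at most 4. *)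
Lemma integral_quartic_gauss i j :
  (\int[lebn]_t (quartic i j t * expR (- sqnorm t))%:E =
   (Num.sqrt pi ^+ n * ((1 + 2 *+ (i == j)) / 4))%:E)%E.
Proof.
pose e k : nat := ((k == i) + (k == j))%N.
have e2 k : (e k <= 2)%N by rewrite /e; case: (k == i); case: (k == j).
pose g k (x : R) := x ^+ (e k).*2 * expR (- x ^+ 2).
have prodD1 (F : 'I_n -> R) k : \prod_l F l ^+ (l == k) = F k.
  by rewrite (bigD1 k)//= eqxx big1 ?mulr1// => l /negbTE ->.
transitivity (\int[lebn]_t (\prod_k g k (tnth t k))%:E)%E.
  apply: eq_integral => t _; congr EFin.
  rewrite big_split/= -expR_sum -sumrN; congr (_ * _).
  rewrite /quartic -(prodD1 (fun k => tnth t k ^+ 2) i).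
  rewrite -(prodD1 (fun k => tnth t k ^+ 2) j) -big_split/=.
  by apply: eq_bigr => k _; rewrite -exprD -exprM mul2n.
rewrite (@integral_tuple_prod _ _ _ (fun k => Num.sqrt pi * gauss_ratio (e k))); last 3 first.
- move=> k; apply: measurable_funM; first exact: measurable_funX.
  by apply: measurableT_comp => //; apply: measurable_funN; exact: measurable_funX.
- move=> k x; rewrite mulr_ge0 ?expR_ge0//.
  by rewrite -muln2 mulnC exprM exprn_ge0// sqr_ge0.
- by move=> k; rewrite -gauss_moment_le2.
rewrite big_split/= prodr_const card_ord; congr (_ * _)%:E.
rewrite (bigD1 i)//= /e eqxx.
have [->|ij] := eqVneq i j.
  by rewrite big1 ?mulr1 ?/gauss_ratio/=; [field|move=> k /negbTE ->].
rewrite (bigD1 j)/=; last by rewrite eq_sym.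
rewrite eqxx eq_sym (negbTE ij) big1 ?/gauss_ratio/=; first by field.
by move=> k /andP[/negbTE -> /negbTE ->].
Qed.

(** The integral of [w_i ^ 2 w_j ^ 2] over the unit ball, for [i] different from
    [j]. *)
Definition moment_const : R :=
  pi `^ (n%:R / 2) / ((n%:R + 4) * (n%:R + 2) * Gamma (n%:R / 2 + 1)).

(** The Gaussian integral of [w_i ^ 2 w_j ^ 2] is the unit-ball moment times
    [Gamma (n / 2 + 3)].  As this product is finite and positive, so are both
    factors; the functional equation then brings in [Gamma (n / 2 + 1)]. *)
Lemma quartic_ball i j :
  0 < Gamma (n%:R / 2 + 1 : R) /\
  forall r : R, 0 < r ->
  (\int[lebn]_(t in [set t | (sqnorm t < r)%R]) (quartic i j t)%:E =
   (moment_const * (1 + 2 *+ (i == j)) * r `^ ((n%:R + 4) / 2))%:E)%E.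
Proof.
set M := (\int[lebn]_(t in [set t | (sqnorm t < 1)%R]) (quartic i j t)%:E)%E.
have hom (r : R) : 0 < r ->
  (\int[lebn]_(t in [set t | (sqnorm t < r)%R]) (quartic i j t)%:E =
   M * (r `^ ((n%:R + 4) / 2))%:E)%E.
  move=> r0; apply: (@ge0_integral_ball_homogeneous (quartic i j) 4) => //.
  - exact: measurable_quartic.
  - exact: quartic_ge0.
  - by move=> a t _; rewrite /quartic !tnth_mktuple; ring.
have := @integral_expRN_radial R _ _ lebn (quartic i j) sqnorm M _
  (measurable_quartic i j) measurable_sqnorm (quartic_ge0 i j) sqnorm_ge0 hom.
rewrite integral_quartic_gauss.
have n0 : 0 <= n%:R :> R by [].
have -> : (n%:R + 4) / 2 + 1 = n%:R / 2 + 1 + 1 + 1 :> R by field.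
rewrite gammaeD1; last by lra.
rewrite gammaeD1; last by lra.
set c := Num.sqrt pi ^+ n * _.
have c0 : 0 < c.
  by rewrite /c mulr_gt0// ?exprn_gt0 ?sqrtr_gt0 ?pi_gt0// divr_gt0//.
have M0 : (0 <= M)%E.
  by apply: integral_ge0 => t _; rewrite lee_fin quartic_ge0.
have := gammae_ge0 (n%:R / 2 + 1 : R).
rewrite Gamma_gammae /moment_const Gamma_gammae.
set G := gammae _; move=> G0.
have z1 : 0 < n%:R / 2 + 1 + 1 :> R by lra.
have z2 : 0 < n%:R / 2 + 1 :> R by lra.
(* A product of nonnegative extended reals that is finite and positive has
   finite factors. *)
move: M G hom M0 G0 => [m| |] [G| |] hom M0 G0 //; last 3 first.
- by rewrite gt0_muley ?lte_fin// gt0_muley ?lte_fin//;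
    move: M0; rewrite lee_fin le_eqVlt => /predU1P[<-|m0];
    [rewrite mul0e => -[] /eqP; rewrite gt_eqF|rewrite gt0_muley].
- rewrite -!EFinM; move: G0; rewrite lee_fin le_eqVlt => /predU1P[<-|G0].
    by rewrite !mulr0 mule0 => -[] /eqP; rewrite gt_eqF.
  by rewrite gt0_mulye// lte_fin !mulr_gt0.
- by rewrite gt0_muley ?lte_fin// gt0_muley ?lte_fin// gt0_muley.
rewrite -!EFinM /= => -[cE].
have G_gt0 : 0 < G.
  rewrite lt0r -lee_fin G0 andbT; apply/eqP => G00.
  by move: c0; rewrite cE G00 !mulr0 ltxx.
split => // r r0; rewrite hom// -EFinM; congr (_ * _)%:E.
have -> : pi `^ (n%:R / 2) = Num.sqrt pi ^+ n :> R.
  by rewrite mulrC powRrM powR12_sqrt ?pi_ge0// powR_mulrn// sqrtr_ge0.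
have -> : m = c / ((n%:R / 2 + 1 + 1) * (n%:R / 2 + 1) * G).
  by rewrite cE mulrA [_ * G]mulrC; field; rewrite !gt_eqF//; lra.
rewrite /c; field; rewrite !gt_eqF//=; lra.
Qed.

End ball_moments.

(** * Second-order Taylor expansion and symmetry of the Hessian *)

Section calculus.
Context {R : realType} {n : nat}.
Local Notation V := 'rV[R]_n.
Implicit Types (f : V -> R) (x y v w : V) (i j k l : 'I_n).
Local Notation unitv i := (delta_mx ord0 i : V).

Lemma ler_coord_norm w i : `|w ord0 i| <= `|w|.
Proof.
rewrite -[leRHS]/(mx_norm w) mx_normrE.
by apply/bigmax_geP; right => /=; exists (ord0, i).
Qed.

Lemma norm_le_coord w (r : R) : 0 <= r -> (forall i, `|w ord0 i| <= r) -> `|w| <= r.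
Proof.
move=> r0 wr; rewrite -[leLHS]/(mx_norm w) mx_normrE.
by apply/bigmax_leP; split => // -[a b] _ /=; rewrite ord1.
Qed.

(** The topology of ['rV_n] is that of the sup norm. *)
Lemma cvg_rowP (F : set_system R) (FF : Filter F) (f : R -> V) (l : V) :
  (forall i, f e ord0 i @[e --> F] --> l ord0 i) -> f e @[e --> F] --> l.
Proof.
move=> fl; apply/cvgrPdist_le => e e0.
have : \forall a \near F, forall i, `|l ord0 i - f a ord0 i| <= e.
  apply: filter_forall => i; have /cvgrPdist_le := fl i; exact.
apply: filterS => a H; apply: norm_le_coord => [|i]; first exact: ltW.
by rewrite !mxE.
Qed.

Lemma is_derive_line f y v (t d : R) :
  is_derive (y + t *: v) v f d -> is_derive t 1 (fun s : R => f (y + s *: v)) d.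
Proof.
have E : (fun h : R => h^-1 *: (((fun s : R => f (y + s *: v)) \o shift t) (h *: 1)
            - f (y + t *: v))) =
    (fun h : R => h^-1 *: ((f \o shift (y + t *: v)) (h *: v) - f (y + t *: v))).
  apply/funext => h /=; congr (_ *: (f _ - _)).
  by rewrite [h *: 1]mulr1 scalerDl addrCA.
move=> [df fd]; split; first by rewrite /derivable E.
by rewrite /derive E.
Qed.

(** The mean value theorem along a coordinate line; [h] may be negative. *)
Lemma partial_MVT f i y (h : R) : (forall z, derivable f z (unitv i)) ->
  exists2 c : R, `|c| <= `|h| &
    f (y + h *: unitv i) - f y = h * partial i f (y + c *: unitv i).
Proof.
move=> df.
pose g (s : R) := f (y + s *: unitv i).
have dg (s : R) : is_derive s 1 g (partial i f (y + s *: unitv i)).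
  by apply: is_derive_line; exact: DeriveDef.
have cg (A : set R) : {within A, continuous g}.
  apply: continuous_subspaceT => s; apply: differentiable_continuous.
  by apply/derivable1_diffP; have [] := dg s.
have g0 : f y = g 0 by rewrite /g scale0r addr0.
rewrite -/(g h) g0; have [h0|h0] := leP 0 h.
  have [c + ->] := MVT_segment h0 (fun s _ => dg s) (cg _).
  rewrite in_itv/= => /andP[c0 ch]; exists c; last by rewrite subr0 mulrC.
  by rewrite !ger0_norm// (le_trans c0).
have [c + E] := MVT_segment (ltW h0) (fun s _ => dg s) (cg _).
rewrite in_itv/= => /andP[ch c0]; exists c.
  by rewrite (ler0_norm c0) (ler0_norm (ltW h0)) lerN2.
by rewrite -opprB E sub0r mulrN opprK mulrC.
Qed.

Lemma Ck_continuous (k : nat) f : Ck k f -> continuous f.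
Proof. by case: k => [|k] []. Qed.

Lemma Ck_derivable (k : nat) f i x : Ck k.+1 f -> derivable f x (unitv i).
Proof. by move=> [_ /(_ i)[]]. Qed.

Lemma Ck_partial (k : nat) f i : Ck k.+1 f -> Ck k (partial i f).
Proof. by move=> [_ /(_ i)[]]. Qed.

Lemma Ck_pred (k : nat) f : Ck k.+1 f -> Ck k f.
Proof.
elim: k f => [|k IH] f [cf H]; split => // i.
by have [df Cf] := H i; split => //; exact: IH.
Qed.

(** The vertices of the staircase path from [0] to [w], one coordinate at a
    time. *)
Definition row_prefix (w : V) (k : nat) : V := \row_j (if (j < k)%N then w ord0 j else 0).

Lemma row_prefix0 w : row_prefix w 0 = 0.
Proof. by apply/rowP => j; rewrite !mxE. Qed.

Lemma row_prefixn w : row_prefix w n = w.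
Proof. by apply/rowP => j; rewrite !mxE ltn_ord. Qed.

Lemma row_prefixS w k : row_prefix w k.+1 = row_prefix w k + w ord0 k *: unitv k.
Proof.
apply/rowP => j; rewrite !mxE ltnS leq_eqVlt eqxx/=.
have [->|jk] := eqVneq j k; first by rewrite eqxx ltnn mulr1 add0r.
by rewrite -val_eqE/= in jk *; rewrite (negbTE jk)/= mulr0 addr0.
Qed.

Lemma continuous_near_norm f x (e : R) : continuous f -> 0 < e ->
  exists2 d : R, 0 < d & forall w, `|w| < d -> `|f (x + w) - f x| <= e.
Proof.
move=> cf e0; have /cvgrPdist_le/(_ e e0) := cf x.
move=> /nbhs_ballP[d /= d0 H]; exists d => // w wd.
rewrite distrC; apply: H; rewrite mx_norm_ball /ball_/=.
by rewrite opprD addrA subrr sub0r normrN.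
Qed.

(** Differentiability from continuity of the partial derivatives: apply the mean
    value theorem on each step of the staircase path from [x] to [x + w]. *)
Lemma taylor1 f x (e : R) : Ck 1 f -> 0 < e ->
  exists2 d : R, 0 < d & forall w, `|w| < d ->
    `|f (x + w) - f x - \sum_k w ord0 k * partial k f x| <= e * `|w|.
Proof.
move=> C1f e0; pose e' := e / (n%:R + 1).
have e'0 : 0 < e' by rewrite divr_gt0// ltr_wpDl.
have /choice[d dP] k : exists d : R, 0 < d /\
    forall w, `|w| < d -> `|partial k f (x + w) - partial k f x| <= e'.
  have [d d0 H] := @continuous_near_norm (partial k f) x e'
    (Ck_continuous _ _ (Ck_partial _ _ k C1f)) e'0.
  by exists d.
exists (\big[Num.min/1]_k d k).
  by elim/big_ind: _ => // [a b a0 b0|k _]; rewrite ?lt_min ?a0//; exact: (dP k).1.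
move=> w wd.
have wdk k : `|w| < d k.
  by apply: lt_le_trans wd _; apply: bigmin_le_cond.
have -> : f (x + w) - f x =
    \sum_(k < n) (f (x + row_prefix w k.+1) - f (x + row_prefix w k)).
  rewrite -(big_mkord xpredT (fun m : nat => f (x + row_prefix w m.+1) - f (x + row_prefix w m))).
  by rewrite telescope_sumr// row_prefixn row_prefix0 addr0.
rewrite -sumrB; apply: le_trans (ler_norm_sum _ _ _) _.
have : \sum_(k < n) `|w| * e' <= e * `|w|.
  rewrite sumr_const card_ord -mulr_natl mulrCA [leRHS]mulrC ler_wpM2l//.
  rewrite /e' mulrA ler_pdivrMr ?ltr_wpDl// mulrC ler_wpM2l ?ltW//.
  by rewrite ltrDl.
apply: le_trans; apply: ler_sum => k _.
rewrite row_prefixS addrA.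
have [c ck ->] := @partial_MVT f k (x + row_prefix w k) (w ord0 k)
  (fun z => Ck_derivable _ _ k z C1f).
rewrite -mulrBr normrM ler_pM// ?ler_coord_norm// -addrA.
apply: (dP k).2; apply: le_lt_trans (wdk k).
apply: norm_le_coord => // j; rewrite !mxE eqxx/=.
have [->|jk] := eqVneq j k.
  by rewrite ltnn add0r mulr1 (le_trans ck)// ler_coord_norm.
by rewrite mulr0 addr0; case: ifP => _; rewrite ?normr0// ler_coord_norm.
Qed.

Lemma is_derive_line_C1 f x w (t : R) : Ck 1 f ->
  is_derive t 1 (fun s : R => f (x + s *: w))
    (\sum_k w ord0 k * partial k f (x + t *: w)).
Proof.
move=> C1f; set D := \sum_k _.
suff H : (fun h : R => h^-1 *: (((fun s : R => f (x + s *: w)) \o shift t) (h *: 1)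
            - f (x + t *: w))) h @[h --> 0^'] --> D.
  by split; [apply/cvg_ex; exists D|exact: cvg_lim].
apply/cvgrPdist_le => e e0.
pose e' := e / (`|w| + 1).
have e'0 : 0 < e' by rewrite divr_gt0// ltr_wpDl.
have [d d0 H] := @taylor1 f (x + t *: w) e' C1f e'0.
near=> h.
have h0 : h != 0 by near: h; exact: nbhs_dnbhs_neq.
have hd : `|h| < d / (`|w| + 1).
  near: h; apply: dnbhs0_lt; rewrite divr_gt0// ltr_wpDl//.
have hwd : `|h *: w| < d.
  rewrite normrZ; move: hd; rewrite ltr_pdivlMr ?ltr_wpDl//.
  by apply: le_lt_trans; rewrite ler_wpM2l// lerDl.
have := H (h *: w) hwd.
rewrite /= [h *: 1]mulr1 scalerDl [_ *: w + _]addrC addrA.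
set A := f (x + _ + _) - _.
have -> : \sum_k (h *: w) ord0 k * partial k f (x + t *: w) = h * D.
  by rewrite mulr_sumr; apply: eq_bigr => k _; rewrite mxE mulrA.
move=> AhD; have -> : D - h^-1 *: A = - (h^-1 * (A - h * D)).
  by rewrite -[h^-1 *: A]/(h^-1 * A); field.
rewrite normrN normrM normfV ler_pdivrMl ?normr_gt0//.
apply: le_trans AhD _; rewrite normrZ mulrCA ler_wpM2l// /e'.
by rewrite mulrAC ler_pdivrMr ?ltr_wpDl// ler_wpM2l ?lerDl// ltW.
Unshelve. all: by end_near. Qed.

Definition taylor2_rem f x w : R :=
  f (x + w) - f x - \sum_k w ord0 k * partial k f x
  - 2^-1 * \sum_k \sum_l w ord0 k * w ord0 l * partial l (partial k f) x.

(** As a function of [c], the remainder at [c w] has derivative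
    [sum_k w_k (D_k f (x + c w) - D_k f x - sum_l c w_l D_l D_k f x)]; bound it by
    [taylor1] applied to each [D_k f] and use the mean value theorem on
    [0 <= c <= 1]. *)
Lemma taylor2 f x (e : R) : Ck 2 f -> 0 < e ->
  exists2 d : R, 0 < d & forall w, `|w| < d ->
    `|taylor2_rem f x w| <= e * `|w| ^+ 2.
Proof.
move=> C2f e0; pose e' := e / (n%:R + 1).
have e'0 : 0 < e' by rewrite divr_gt0// ltr_wpDl.
have /choice[d dP] k : exists d : R, 0 < d /\
    forall w, `|w| < d -> `|partial k f (x + w) - partial k f x -
      \sum_l w ord0 l * partial l (partial k f) x| <= e' * `|w|.
  have [d d0 H] := @taylor1 (partial k f) x e' (Ck_partial _ _ k C2f) e'0.
  by exists d.
have C1f : Ck 1 f by exact: Ck_pred.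
exists (\big[Num.min/1]_k d k).
  by elim/big_ind: _ => // [a b a0 b0|k _]; rewrite ?lt_min ?a0//; exact: (dP k).1.
move=> w wd.
have wdk k : `|w| < d k by apply: lt_le_trans wd _; apply: bigmin_le_cond.
pose L := \sum_k w ord0 k * partial k f x.
pose Q := \sum_k \sum_l w ord0 k * w ord0 l * partial l (partial k f) x.
pose phi (s : R) := f (x + s *: w) - s * L - s ^+ 2 * (2^-1 * Q).
pose dphi (s : R) := \sum_k w ord0 k * partial k f (x + s *: w) - L - s * Q.
have dphiP (s : R) : is_derive s 1 phi (dphi s).
  have H1 := @is_derive_line_C1 f x w s C1f.
  have H2 : is_derive s 1 (fun s : R => s * L) L.
    have -> : (fun s : R => s * L) = L \*: id.
      by apply/funext => r /=; rewrite /GRing.scale/= mulrC.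
    by apply: is_derive_eq; rewrite /GRing.scale/= mulr1.
  have H3 : is_derive s 1 (fun s : R => s ^+ 2 * (2^-1 * Q)) (s * Q).
    have -> : (fun s : R => s ^+ 2 * (2^-1 * Q)) = (2^-1 * Q) \*: ((id : R -> R) ^+ 2).
      by apply/funext => r /=; rewrite /GRing.scale/= mulrC.
    by apply: is_derive_eq; rewrite /GRing.scale/= mulr1 expr1; field.
  exact: is_deriveB (is_deriveB H1 H2) H3.
have cphi : {within `[0, 1], continuous phi}.
  apply: continuous_subspaceT => s; apply: differentiable_continuous.
  by apply/derivable1_diffP; have [] := dphiP s.
have [c c01 phiE] := MVT_segment ler01 (fun s _ => dphiP s) cphi.
have -> : taylor2_rem f x w = dphi c.
  rewrite -[RHS]mulr1 -[X in _ * X]subr0 -phiE /phi /taylor2_rem -/L -/Q.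
  by rewrite scale1r scale0r addr0; ring.
have -> : dphi c = \sum_k w ord0 k * (partial k f (x + c *: w) - partial k f x
   - \sum_l (c *: w) ord0 l * partial l (partial k f) x).
  rewrite /dphi /L /Q mulr_sumr -!sumrB; apply: eq_bigr => k _.
  rewrite mulr_sumr !mulrBr mulr_sumr; congr (_ - _); apply: eq_bigr => l _.
  by rewrite mxE; ring.
move: c01; rewrite in_itv/= => /andP[c0 c1].
apply: le_trans (ler_norm_sum _ _ _) _.
have : \sum_(k < n) `|w| * (e' * `|w|) <= e * `|w| ^+ 2.
  rewrite sumr_const card_ord -mulr_natl.
  have -> : n%:R * (`|w| * (e' * `|w|)) = (e' * n%:R) * `|w| ^+ 2 by ring.
  rewrite ler_wpM2r ?sqr_ge0// /e' mulrAC ler_pdivrMr ?ltr_wpDl//.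
  by rewrite ler_wpM2l ?lerDl// ltW.
apply: le_trans; apply: ler_sum => k _; rewrite normrM ler_pM ?ler_coord_norm//.
have cw : `|c *: w| <= `|w| by rewrite normrZ ger0_norm// ler_piMl.
apply: le_trans ((dP k).2 _ (le_lt_trans cw (wdk k))) _.
by rewrite ler_wpM2l// ltW.
Qed.

Lemma is_derive_translate f y v w (d : R) :
  is_derive (y + w) v f d -> is_derive y v (fun z => f (z + w)) d.
Proof.
have E : (fun h : R => h^-1 *: (((fun z => f (z + w)) \o shift y) (h *: v) - f (y + w))) =
    (fun h : R => h^-1 *: ((f \o shift (y + w)) (h *: v) - f (y + w))).
  by apply/funext => h /=; rewrite addrA.
by move=> [df fd]; split; [rewrite /derivable E|rewrite /derive E].
Qed.

(** Two applications of the mean value theorem, first in direction [i] to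
    [y |-> f (y + h e_j) - f y], then in direction [j] to [D_i f]. *)
Lemma partial_second_difference f i j x (h : R) : Ck 2 f ->
  exists2 z : V, `|z| <= 2 * `|h| &
    f (x + h *: unitv i + h *: unitv j) - f (x + h *: unitv i)
    - f (x + h *: unitv j) + f x = h ^+ 2 * partial j (partial i f) (x + z).
Proof.
move=> C2f.
pose F y := f (y + h *: unitv j) - f y.
have dF y : is_derive y (unitv i) F
    (partial i f (y + h *: unitv j) - partial i f y).
  apply: is_deriveB; last exact/DeriveDef/erefl/Ck_derivable/C2f.
  exact/is_derive_translate/DeriveDef/erefl/Ck_derivable/C2f.
have [c ch FE] := @partial_MVT F i x h (fun y => @ex_derive _ _ _ _ _ _ _ (dF y)).
have [d dh GE] := @partial_MVT (partial i f) j (x + c *: unitv i) h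
  (fun z => Ck_derivable _ _ j z (Ck_partial _ _ i C2f)).
have unit_le1 k : `|unitv k| <= 1.
  by apply: norm_le_coord => // l; rewrite mxE; case: (_ && _); rewrite ?normr1 ?normr0.
exists (c *: unitv i + d *: unitv j).
  rewrite (le_trans (ler_normD _ _))// !normrZ mulr_natl mulr2n.
  by rewrite lerD// -[leRHS]mulr1 ler_pM.
have -> : f (x + h *: unitv i + h *: unitv j) - f (x + h *: unitv i)
    - f (x + h *: unitv j) + f x = F (x + h *: unitv i) - F x.
  by rewrite /F; ring.
have dFE := @derive_val _ _ _ _ _ _ _ (dF (x + c *: unitv i)).
by rewrite FE {1}/partial dFE GE addrA expr2 mulrA.
Qed.

(** The second difference is symmetric in [i] and [j]; divide it by [h ^ 2] and
    let [h] tend to [0]. *)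
Lemma partialC f i j x : Ck 2 f ->
  partial i (partial j f) x = partial j (partial i f) x.
Proof.
move=> C2f; apply/eqP; rewrite -subr_eq0 -normr_le0; apply/ler_addgt0Pl => e e0.
rewrite addr0.
have e2 : 0 < e / 2 by rewrite divr_gt0.
have [d d0 dP] := @continuous_near_norm _ x _ (Ck_continuous _ _
  (Ck_partial _ _ i (Ck_partial _ _ j C2f))) e2.
have [d' d'0 d'P] := @continuous_near_norm _ x _ (Ck_continuous _ _
  (Ck_partial _ _ j (Ck_partial _ _ i C2f))) e2.
(* The intermediate points are at distance at most [2 h] from [x]. *)
pose h := Num.min d d' / 3.
have m0 : 0 < Num.min d d' by rewrite lt_min d0.
have h0 : 0 < h by rewrite divr_gt0.
have hm : 2 * `|h| < Num.min d d' by rewrite gtr0_norm// /h; lra.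
have [z zh zE] := @partial_second_difference f i j x h C2f.
have [z' z'h z'E] := @partial_second_difference f j i x h C2f.
have zz' : partial j (partial i f) (x + z) = partial i (partial j f) (x + z').
  apply: (@mulfI _ (h ^+ 2)); first by rewrite expf_neq0// gt_eqF.
  apply: (etrans (esym zE)); apply: etrans z'E; rewrite (addrAC x (h *: unitv i) (h *: unitv j)).
  by congr (_ + f x); exact: addrAC.
have zd : `|z| < d'.
  by apply: le_lt_trans zh _; apply: lt_le_trans hm _; rewrite ge_min lexx orbT.
have z'd : `|z'| < d.
  by apply: le_lt_trans z'h _; apply: lt_le_trans hm _; rewrite ge_min lexx.
rewrite (splitr e) -(subrKA (partial i (partial j f) (x + z'))).
apply: le_trans (ler_normD _ _) _; apply: lerD; first by rewrite distrC; exact: dP.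
by rewrite -zz'; exact: d'P.
Qed.

End calculus.

(** * The Taylor remainder on a ball *)

Section taylor_remainder.
Context {R : realType} {n : nat}.
Local Notation V := 'rV[R]_n.
Implicit Types (f : V -> R) (x w : V).

Lemma norm_le_enorm w : `|w| <= enorm w.
Proof.
apply: norm_le_coord => [|i]; first exact: sqrtr_ge0.
rewrite -sqrtr_sqr ler_wsqrtr// (bigD1 i)//= lerDl.
by apply: sumr_ge0 => j _; exact: sqr_ge0.
Qed.

Lemma continuous_taylor2_rem f x : continuous f -> continuous (taylor2_rem f x).
Proof.
move=> cf w; rewrite /taylor2_rem /continuous_at.
have cc i : v ord0 i @[v --> w] --> w ord0 i by exact: coord_continuous.
have cfx : f (x + v) @[v --> w] --> f (x + w).
  apply: (@cvg_comp _ _ _ (fun v => x + v) f _ (nbhs (x + w))); last exact: cf.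
  exact: (@cvgD _ V _ (nbhs w) _ (cst x) id x w (cvg_cst x) (@cvg_id _ _)).
move: (nbhs w) (nbhs_filter w) cc cfx => F FF cc cfx.
apply: cvgB; last first.
  apply: cvgM; first exact: cvg_cst.
  apply: cvg_big => [|k _]; first exact: add_continuous.
  apply: cvg_big => [|l _]; first exact: add_continuous.
  by apply: cvgM; last exact: cvg_cst; apply: cvgM; exact: cc.
apply: cvgB; last first.
  apply: cvg_big => [|k _]; first exact: add_continuous.
  by apply: cvgM; [exact: cc|exact: cvg_cst].
by apply: cvgB; last exact: cvg_cst.
Qed.

(** Close to [0] this is [taylor2]; farther away [|w|] is bounded below and the
    remainder is bounded by compactness, so the cubic term takes over. *)
Lemma taylor2_rem_le f x (r e : R) : Ck 2 f -> 0 < e ->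
  exists2 K : R, 0 <= K & forall w, enorm w <= r ->
    `|taylor2_rem f x w| <= e * enorm w ^+ 2 + K * enorm w ^+ 3.
Proof.
move=> C2f e0; have [d d0 dP] := @taylor2 R n f x e C2f e0.
pose A : set V := [set v | forall i, `[- r, r]%classic (v ord0 i)].
have cA : compact A.
  by apply: (@rV_compact R n (fun=> `[- r, r]%classic)) => i; exact: segment_compact.
have cf : {within A, continuous (taylor2_rem f x)}.
  by apply: continuous_subspaceT; exact/continuous_taylor2_rem/Ck_continuous/C2f.
have [M [_ MP]] := compact_bounded (continuous_compact cf cA).
pose C := `|M| + 1.
have C0 : 0 < C by rewrite ltr_wpDl.
have CP w : A w -> `|taylor2_rem f x w| <= C.
  move=> Aw; apply: (MP C); last by exists w.
  by rewrite /C (le_lt_trans (ler_norm M))// ltrDl.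
exists (C / d ^+ 3); first by rewrite divr_ge0 ?exprn_ge0// ltW.
move=> w wr; have ww := norm_le_enorm w.
have ew0 : 0 <= enorm w by exact: sqrtr_ge0.
have [wd|dw] := ltP `|w| d.
  apply: le_trans (dP _ wd) _; apply: (@le_trans _ _ (e * enorm w ^+ 2)).
    by rewrite ler_wpM2l ?(ltW e0)// lerXn2r ?nnegrE.
  by rewrite lerDl mulr_ge0// ?exprn_ge0// divr_ge0 ?exprn_ge0// ltW.
have Aw : A w.
  move=> i; rewrite /= in_itv/= -ler_norml; apply: le_trans (ler_coord_norm w i) _.
  exact: le_trans ww wr.
apply: le_trans (CP _ Aw) _; apply: (@le_trans _ _ (C / d ^+ 3 * enorm w ^+ 3)).
  rewrite mulrAC ler_pdivlMr ?exprn_gt0// ler_wpM2l ?(ltW C0)//.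
  by rewrite lerXn2r ?nnegrE ?(ltW d0)// (le_trans dw).
by rewrite lerDr mulr_ge0 ?exprn_ge0// ltW.
Qed.

End taylor_remainder.

(** * Measurability of continuous functions *)

Section measurable_continuous.
Context {R : realType} {n : nat}.
Local Notation Rm := (measurableTypeR R).
Local Notation V := 'rV[R]_n.

Lemma row_of_tupleE (t : n.-tuple Rm) i : row_of_tuple t ord0 i = tnth t i.
Proof. by rewrite mxE. Qed.

(** An open set is a union of boxes with rational endpoints, of which there are
    countably many. *)
Lemma measurable_preimage_row_of_tuple (U : set V) : open U ->
  measurable (@row_of_tuple R n @^-1` U).
Proof.
move=> oU.
pose box (c : {ffun 'I_n -> rat * rat}) : set (n.-tuple Rm) :=
  \bigcap_i [set t | ratr (c i).1 < (tnth t i : R) < ratr (c i).2].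
have mbox c : measurable (box c).
  apply: fin_bigcap_measurable => [|i _]; first exact: finite_finset.
  have := @measurable_tnth_real R n i measurableT [set` `]ratr (c i).1, ratr (c i).2[]
    (measurable_itv _).
  by rewrite setTI; congr (measurable _); apply/seteqP; split => t; rewrite /= in_itv.
pose F c := if `[< box c `<=` row_of_tuple @^-1` U >] then box c else set0.
have -> : @row_of_tuple R n @^-1` U = \bigcup_c F c.
  apply/seteqP; split => [t Ut|t [c _]]; last first.
    by rewrite /F; case: asboolP => // H; exact: H.
  have /nbhs_ballP[d /= d0 dU] := open_nbhs_nbhs (conj oU Ut).
  have /choice[c cP] i : exists p : rat * rat,
      tnth t i - d < ratr p.1 < tnth t i /\ tnth t i < ratr p.2 < tnth t i + d.
    have /rat_in_itvoo[a] : tnth t i - d < tnth t i by rewrite ltrBlDr ltrDl.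
    have /rat_in_itvoo[b] : tnth t i < tnth t i + d by rewrite ltrDl.
    by rewrite !in_itv/= => tb ta; exists (a, b).
  exists (finfun c) => //; rewrite /F ifT.
    by move=> i _; rewrite /= ffunE; have [/andP[_ ->] /andP[-> _]] := cP i.
  apply/asboolP => s sbox; apply: dU; split => // i j; rewrite ord1 !row_of_tupleE.
  have := sbox j I; rewrite /= ffunE => /andP[s1 s2].
  have [/andP[t1 t2] /andP[t3 t4]] := cP j.
  by rewrite /ball/= ltr_norml; apply/andP; split; lra.
apply: countable_bigcupT_measurable => [|c]; first exact: countableP.
by rewrite /F; case: ifP.
Qed.

Lemma continuous_measurable_row_of_tuple (f : V -> R) : continuous f ->
  measurable_fun setT (fun t : n.-tuple Rm => f (row_of_tuple t)).
Proof.
move=> /continuousP cf; apply: (measurability _ (RGenOpens.measurableE R)).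
move=> _ [_ [a [b ->] <-]]; rewrite setTI.
apply: (measurable_preimage_row_of_tuple (f @^-1` `]a, b[%classic)).
exact/cf/interval_open.
Qed.

End measurable_continuous.

(** * Finite sums and domination *)

Section Rintegral_finite_sums.
Context (d : measure_display) (T : measurableType d) (R : realType)
  (mu : {measure set T -> \bar R}).
Variables (D : set T).
Hypothesis mD : measurable D.

Lemma integrable_add (f g : T -> R) :
  mu.-integrable D (EFin \o f) -> mu.-integrable D (EFin \o g) ->
  mu.-integrable D (EFin \o (fun x => f x + g x)).
Proof. by move=> fi gi; exact: (integrableD mD fi gi). Qed.

Lemma integrable_bigsum (I : Type) (r : seq I) (h : I -> T -> R) :
  (forall i, mu.-integrable D (EFin \o h i)) ->
  mu.-integrable D (EFin \o (fun x => \sum_(i <- r) h i x)).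
Proof.
move=> hi; elim: r => [|i r IH].
  rewrite (_ : _ \o _ = cst 0%E); first exact: integrable0.
  by apply/funext => x /=; rewrite big_nil.
rewrite (_ : _ \o _ = EFin \o (fun x => h i x + \sum_(i <- r) h i x)).
  exact: integrable_add.
by apply/funext => x /=; rewrite big_cons.
Qed.

Lemma Rintegral_bigsum (I : Type) (r : seq I) (h : I -> T -> R) :
  (forall i, mu.-integrable D (EFin \o h i)) ->
  \int[mu]_(x in D) (\sum_(i <- r) h i x) = \sum_(i <- r) \int[mu]_(x in D) h i x.
Proof.
move=> hi; elim: r => [|i r IH].
  rewrite big_nil -[RHS](mul0r (fine (mu D))) -Rintegral_cst//.
  by apply: eq_Rintegral => x _; rewrite big_nil.
rewrite big_cons -IH -RintegralD//; last exact: integrable_bigsum.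
by apply: eq_Rintegral => x _; rewrite big_cons.
Qed.

Lemma integrable_dominated (f g : T -> R) (M : R) : measurable_fun setT f ->
  mu.-integrable D (EFin \o g) -> (forall x, D x -> `|f x| <= M * g x) ->
  mu.-integrable D (EFin \o f).
Proof.
move=> mf gi fg; apply: (@le_integrable _ _ _ mu D mD _ (EFin \o (fun x => M * g x))).
- by apply/measurable_EFinP; exact: measurable_funTS.
- by move=> x Dx /=; rewrite lee_fin (le_trans (fg x Dx))// ler_norm.
- exact: integrable_scale.
Qed.

Lemma normr_Rintegral_le (f g : T -> R) (M : R) : measurable_fun setT f ->
  mu.-integrable D (EFin \o g) -> (forall x, D x -> `|f x| <= M * g x) ->
  `|\int[mu]_(x in D) f x| <= M * \int[mu]_(x in D) g x.
Proof.
move=> mf gi fg; have fi := integrable_dominated _ _ _ mf gi fg.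
apply: le_trans (le_normr_Rintegral mD fi) _.
rewrite -RintegralZl//; apply: le_Rintegral => //.
- exact: integrable_norm.
- exact: integrable_scale.
Qed.

End Rintegral_finite_sums.

(** * Weighted moments of balls *)

Section radial_moments.
Context {R : realType} {n : nat}.
Local Notation Rm := (measurableTypeR R).
Local Notation lebn := (lebesgue_tuple R n).
Implicit Types (t : n.-tuple Rm) (i j k l : 'I_n) (D s : R).

(** A change of signs preserves Lebesgue measure and exchanges the positive and
    the negative part of [h]. *)
Lemma Rintegral_odd (a : 'I_n -> R) (Om : set (n.-tuple Rm))
    (h : n.-tuple Rm -> R) :
  (forall i, `|a i| = 1) -> measurable Om -> measurable_fun setT h ->
  (forall t, Om (tuple_dilation a t) = Om t) ->
  (forall t, h (tuple_dilation a t) = - h t) ->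
  \int[lebn]_(t in Om) h t = 0.
Proof.
move=> a1 mO mh Oa ha.
have a0 i : a i != 0 by rewrite -normr_eq0 a1 oner_eq0.
pose f := (EFin \o h) \_ Om.
have mf : measurable_fun setT f.
  apply/(measurable_restrictT _ _).1 => //.
  by apply/measurable_EFinP; exact: measurable_funTS.
have E : (\int[lebn]_t f^\-%E t = \int[lebn]_t f^\+%E t)%E.
  have := @ge0_integral_tuple_dilation R n a f^\+%E a0 _ (funepos_ge0 _).
  rewrite (eq_bigr (fun=> 1)); last by move=> i _; rewrite a1 invr1.
  rewrite big1_eq mul1e => <-; last exact: measurable_funepos.
  apply: eq_integral => t _; rewrite funeposE funenegE /f !patchE.
  have -> : (tuple_dilation a t \in Om) = (t \in Om).
    by apply/idP/idP; rewrite !inE Oa.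
  by case: ifPn => _ /=; [rewrite ha|exact: (congr1 (fun y : \bar R => maxe y 0%E) oppe0)].
rewrite /Rintegral integral_mkcond integralE -/f E.
by case: (\int[lebn]_t f^\+%E t)%E => //= r; rewrite subrr.
Qed.

Local Notation E := ((n%:R + 4) / 2 : R).

(** The integral of [w_i ^ 2 w_j ^ 2 |w| ^ (2 s)] over the ball [|w| ^ 2 < D],
    for [i] different from [j]. *)
Definition radial_moment D s : R :=
  @moment_const R n * (E / (E + s)) * D `^ (E + s).

Lemma sqnorm_eq0 t i : sqnorm t = 0 -> tnth t i = 0 :> R.
Proof.
move=> /eqP; rewrite psumr_eq0; last by move=> j _; exact: sqr_ge0.
by move=> /allP/(_ i (mem_index_enum _)); rewrite sqrf_eq0 => /eqP.
Qed.

Lemma integral_quartic_power i j D s : 0 < D -> 0 < E + s ->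
  (\int[lebn]_(t in [set t | (sqnorm t < D)%R])
      (quartic i j t * sqnorm t `^ s)%:E
   = ((1 + 2 *+ (i == j)) * radial_moment D s)%:E)%E.
Proof.
move=> D0 Es; have E0 : 0 < E by rewrite divr_gt0// ltr_wpDl.
rewrite (@integral_radial_power _ _ _ lebn (quartic i j) sqnorm
  (@moment_const R n * (1 + 2 *+ (i == j))) E) //.
- by congr EFin; rewrite /radial_moment; ring.
- exact: measurable_quartic.
- exact: measurable_sqnorm.
- exact: quartic_ge0.
- exact: sqnorm_ge0.
- by move=> t t0; rewrite /quartic sqnorm_eq0// expr0n mul0r.
- by move=> r r0; rewrite (quartic_ball i j).2.
Qed.

Lemma measurable_sqnorm_powR s : measurable_fun setT (fun t => sqnorm t `^ s).
Proof. exact: (measurableT_comp (measurable_powR _) measurable_sqnorm). Qed.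

Lemma integrable_quartic_power i j D s : 0 < D -> 0 < E + s ->
  lebn.-integrable [set t | sqnorm t < D]
    (EFin \o (fun t => quartic i j t * sqnorm t `^ s)).
Proof.
move=> D0 Es; apply: ge0_integrable_EFin (integral_quartic_power i j D s D0 Es).
- exact: measurable_sqnorm_ball.
- by apply: measurable_funM; [exact: measurable_quartic|exact: measurable_sqnorm_powR].
- by move=> t _; rewrite mulr_ge0 ?quartic_ge0 ?powR_ge0.
Qed.

Lemma sqnorm_sqrE t : sqnorm t ^+ 2 = \sum_i \sum_j quartic i j t.
Proof.
rewrite expr2 {1}/sqnorm mulr_suml; apply: eq_bigr => i _.
by rewrite /sqnorm mulr_sumr.
Qed.

Lemma integrable_sqnorm_power D s : 0 < D -> 0 < E + s ->
  lebn.-integrable [set t | sqnorm t < D]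
    (EFin \o (fun t => sqnorm t ^+ 2 * sqnorm t `^ s)).
Proof.
move=> D0 Es.
rewrite (_ : _ \o _ = EFin \o (fun t => \sum_i \sum_j (quartic i j t * sqnorm t `^ s))).
  apply: integrable_bigsum => [|i]; first exact: measurable_sqnorm_ball.
  apply: integrable_bigsum => [|j]; first exact: measurable_sqnorm_ball.
  exact: integrable_quartic_power.
apply/funext => t /=; rewrite sqnorm_sqrE mulr_suml; congr EFin.
by apply: eq_bigr => i _; rewrite mulr_suml.
Qed.

Lemma Rintegral_sqnorm_power D s : 0 < D -> 0 < E + s ->
  \int[lebn]_(t in [set t | sqnorm t < D]) (sqnorm t ^+ 2 * sqnorm t `^ s) =
  n%:R * (n%:R + 2) * radial_moment D s.
Proof.
move=> D0 Es.
under eq_Rintegral => t _.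
  rewrite sqnorm_sqrE mulr_suml.
  under eq_bigr do rewrite mulr_suml.
over.
rewrite Rintegral_bigsum => [|//|i]; last 2 first.
- exact: measurable_sqnorm_ball.
- apply: integrable_bigsum => [|j]; first exact: measurable_sqnorm_ball.
  exact: integrable_quartic_power.
transitivity (\sum_(i < n) \sum_(j < n) (1 + 2 *+ (i == j)) * radial_moment D s).
  apply: eq_bigr => i _; rewrite Rintegral_bigsum; last 2 first.
  - exact: measurable_sqnorm_ball.
  - by move=> j; exact: integrable_quartic_power.
  by apply: eq_bigr => j _; rewrite /Rintegral integral_quartic_power.
under eq_bigr => i _.
  rewrite -mulr_suml big_split/= sumr_const card_ord (bigD1 i)//= eqxx big1; last first.
    by move=> j /negbTE; rewrite eq_sym => ->; rewrite mulr0n.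
over.
by rewrite addr0 sumr_const card_ord -[LHS]mulr_natl mulrA.
Qed.

Definition monomial4 k l j i t : R := tnth t k * tnth t l * (tnth t j * tnth t i).

Lemma ler_tnth_sqnorm t i j : `|tnth t i * tnth t j| <= sqnorm t.
Proof.
have le1 k : tnth t k ^+ 2 <= sqnorm t.
  by rewrite /sqnorm (bigD1 k)//= lerDl sumr_ge0// => l _; exact: sqr_ge0.
have := le1 i; have := le1 j; have := sqr_ge0 (`|tnth t i| - `|tnth t j|).
rewrite normrM -[tnth t i ^+ 2]real_normK ?num_real// -[tnth t j ^+ 2]real_normK ?num_real//.
nra.
Qed.

Lemma measurable_monomial4 k l j i : measurable_fun setT (monomial4 k l j i).
Proof.
by apply: measurable_funM; apply: measurable_funM; exact: measurable_tnth_real.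
Qed.

Lemma ler_monomial4 k l j i t : `|monomial4 k l j i t| <= sqnorm t ^+ 2.
Proof. by rewrite normrM expr2 ler_pM// ler_tnth_sqnorm. Qed.

Definition reflection (m : 'I_n) : n.-tuple Rm -> n.-tuple Rm :=
  tuple_dilation (fun i => if i == m then -1 else 1).

Lemma sqnorm_sign (a : 'I_n -> R) t : (forall i, `|a i| = 1) ->
  sqnorm (tuple_dilation a t) = sqnorm t.
Proof.
move=> a1; apply: eq_bigr => i _.
by rewrite tnth_mktuple exprMn -[a i ^+ 2]real_normK ?num_real// a1 expr1n mul1r.
Qed.

Lemma reflection_signs m i : `|if i == m then -1 else 1 : R| = 1.
Proof. by case: eqP => _; rewrite ?normrN normr1. Qed.

Lemma tnth_reflection m t i :
  tnth (reflection m t) i = (if i == m then - tnth t i else tnth t i) :> R.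
Proof. by rewrite tnth_mktuple; case: ifP => _; rewrite ?mulN1r ?mul1r. Qed.

(** If the four indices do not pair up, one of them occurs an odd number of times
    and the reflection in that coordinate changes the sign of the integrand.
    Otherwise the monomial is [quartic]. *)
Lemma Rintegral_monomial4 k l j i D s : 0 < D -> 0 < E + s ->
  \int[lebn]_(t in [set t | sqnorm t < D]) (monomial4 k l j i t * sqnorm t `^ s) =
  (((k == l) && (j == i))%:R + ((k == j) && (l == i))%:R
    + ((k == i) && (l == j))%:R) * radial_moment D s.
Proof.
move=> D0 Es.
have paired a b (h : n.-tuple Rm -> R) : h =1 quartic a b ->
    \int[lebn]_(t in [set t | sqnorm t < D]) (h t * sqnorm t `^ s) =
    (1 + 2 *+ (a == b)) * radial_moment D s.
  move=> hab; under eq_Rintegral do rewrite hab.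
  by rewrite /Rintegral integral_quartic_power.
have unpaired m :
    (forall t, monomial4 k l j i (reflection m t) = - monomial4 k l j i t) ->
    \int[lebn]_(t in [set t | sqnorm t < D]) (monomial4 k l j i t * sqnorm t `^ s) = 0.
  move=> hm; apply: (@Rintegral_odd (fun i => if i == m then -1 else 1)).
  - exact: reflection_signs.
  - exact: measurable_sqnorm_ball.
  - by apply: measurable_funM; [exact: measurable_monomial4|exact: measurable_sqnorm_powR].
  - by move=> t /=; rewrite sqnorm_sign//; exact: reflection_signs.
  - move=> t; rewrite hm sqnorm_sign ?mulNr//; exact: reflection_signs.
have [ekl|kl] := eqVneq k l.
  subst l; have [eji|ji] := eqVneq j i.
    subst i; rewrite (paired k j); last by move=> t; rewrite /monomial4 /quartic !expr2.
    by case: (k == j); rewrite /= ?mulr1n ?mulr0n; ring.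
  have -> : (k == j) && (k == i) = false.
    by apply/negbTE/negP => /andP[/eqP kj /eqP ki]; rewrite -kj ki eqxx in ji.
  have -> : (k == i) && (k == j) = false.
    by apply/negbTE/negP => /andP[/eqP ki /eqP kj]; rewrite -kj ki eqxx in ji.
  rewrite (unpaired j) ?addr0 ?mul0r// => t.
  rewrite /monomial4 !tnth_reflection eqxx (eq_sym i) (negbTE ji).
  by case: eqP => _; ring.
have lk : (l == k) = false by rewrite eq_sym (negbTE kl).
have [ekj|kj] := eqVneq k j.
  subst j; have [eli|li] := eqVneq l i.
    subst i; rewrite (paired k l); last by move=> t; rewrite /monomial4 /quartic !expr2; ring.
    by rewrite (negbTE kl) lk/= mulr0n; ring.
  rewrite (unpaired l) => [|t]; first by rewrite lk !andbF/= !addr0 mul0r.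
  rewrite /monomial4 !tnth_reflection eqxx (negbTE kl) (eq_sym i) (negbTE li); ring.
have [eki|ki] := eqVneq k i.
  subst i; have [elj|lj] := eqVneq l j.
    subst j; rewrite (paired k l); last by move=> t; rewrite /monomial4 /quartic !expr2; ring.
    by rewrite (negbTE kl) /= mulr0n; ring.
  rewrite (unpaired l) => [|t]; first by rewrite /= !addr0 mul0r.
  rewrite /monomial4 !tnth_reflection eqxx (negbTE kl) (eq_sym j) (negbTE lj); ring.
rewrite (unpaired k) => [|t]; first by rewrite /= !addr0 mul0r.
rewrite /monomial4 !tnth_reflection eqxx lk (eq_sym j) (eq_sym i) (negbTE kj) (negbTE ki).
ring.
Qed.

End radial_moments.

(** * The bond integral *)

Section bond.
Context {R : realType} {n : nat}.
Local Notation Rm := (measurableTypeR R).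
Local Notation V := 'rV[R]_n.
Local Notation lebn := (lebesgue_tuple R n).
Variables (u : V -> V) (x : V).
Hypothesis C2u : forall i, Ck 2 (coord_fun u i).
Implicit Types (t : n.-tuple Rm) (i j k l : 'I_n) (beta delta eps : R).

Lemma enorm_row_of_tuple t : enorm (row_of_tuple t) = Num.sqrt (sqnorm t).
Proof.
by congr Num.sqrt; apply: eq_bigr => i _; rewrite row_of_tupleE.
Qed.

(** [|w| ^ (- beta - 2)] as a power of [|w| ^ 2]. *)
Definition kernel_exponent beta : R := - (beta + 2) / 2.
Local Notation s_ := kernel_exponent.

Lemma kernel_powR beta t :
  (enorm (row_of_tuple t) `^ (beta + 2))^-1 = sqnorm t `^ s_ beta.
Proof.
rewrite enorm_row_of_tuple -powR12_sqrt ?sqnorm_ge0// -powRrM -powRN.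
by congr (_ `^ _); rewrite /kernel_exponent; field.
Qed.

Lemma enorm_ball_preimage delta : 0 < delta ->
  row_of_tuple @^-1` [set w : V | enorm w < delta] = [set t | sqnorm t < delta ^+ 2].
Proof.
move=> d0; apply/seteqP; split => t /=; rewrite enorm_row_of_tuple.
  by move=> td; rewrite -(sqr_sqrtr (sqnorm_ge0 t)) ltrXn2r ?nnegrE ?sqrtr_ge0// ltW.
by move=> td; rewrite -[ltRHS]gtr0_norm// -sqrtr_sqr ltr_sqrt ?exprn_gt0.
Qed.

Definition hessian j k l : R := partial l (partial k (coord_fun u j)) x.
Definition taylor_rem j t : R := taylor2_rem (coord_fun u j) x (row_of_tuple t).

(** The contributions to the [i]-th entry of the integrand of the linear part, the
    quadratic part and the remainder of the Taylor expansion of [u] at [x]. *)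
Definition odd_part beta i t : R :=
  \sum_j \sum_k partial k (coord_fun u j) x *
    (tnth t k * (tnth t j * tnth t i) * sqnorm t `^ s_ beta).
Definition quad_part beta i t : R :=
  \sum_j \sum_k \sum_l 2^-1 * hessian j k l *
    (monomial4 k l j i t * sqnorm t `^ s_ beta).
Definition rem_part beta i t : R :=
  \sum_j taylor_rem j t * (tnth t j * tnth t i) * sqnorm t `^ s_ beta.
Definition even_part beta i t : R := quad_part beta i t + rem_part beta i t.

Lemma bond_integrand_decomp beta i t :
  bond_integrand beta u x (row_of_tuple t) ord0 i =
  odd_part beta i t + even_part beta i t.
Proof.
rewrite /bond_integrand kernel_powR !mxE mulr_sumr.
rewrite /odd_part /even_part /quad_part /rem_part -!big_split/=.
apply: eq_bigr => j _; rewrite !mxE.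
set q := sqnorm t `^ _.
have -> : \sum_k partial k (coord_fun u j) x *
     (tnth t k * (tnth t j * tnth t i) * q) =
   (\sum_k tnth t k * partial k (coord_fun u j) x) * (tnth t j * tnth t i * q).
  by rewrite mulr_suml; apply: eq_bigr => k _; ring.
have -> : \sum_k \sum_l 2^-1 * hessian j k l * (monomial4 k l j i t * q) =
   (2^-1 * \sum_k \sum_l tnth t k * tnth t l * hessian j k l) * (tnth t j * tnth t i * q).
  rewrite mulr_sumr mulr_suml; apply: eq_bigr => k _.
  rewrite mulr_sumr mulr_suml; apply: eq_bigr => l _.
  by rewrite /monomial4; ring.
have -> : taylor_rem j t = u (x + row_of_tuple t) ord0 j - u x ord0 j
  - \sum_k tnth t k * partial k (coord_fun u j) x
  - 2^-1 * \sum_k \sum_l tnth t k * tnth t l * hessian j k l.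
  rewrite /taylor_rem /taylor2_rem; congr (_ - _ - _ * _).
    by apply: eq_bigr => k _; rewrite row_of_tupleE.
  by apply: eq_bigr => k _; apply: eq_bigr => l _; rewrite !row_of_tupleE.
ring.
Qed.

Lemma measurable_odd_part beta i : measurable_fun setT (odd_part beta i).
Proof.
apply: measurable_sum => j; apply: measurable_sum => k; apply: measurable_funM => //.
apply: measurable_funM; last exact: measurable_sqnorm_powR.
by do 2?[apply: measurable_funM]; exact: measurable_tnth_real.
Qed.

Lemma measurable_taylor_rem j : measurable_fun setT (taylor_rem j).
Proof.
apply: continuous_measurable_row_of_tuple; apply: continuous_taylor2_rem.
exact: Ck_continuous (C2u j).
Qed.

Lemma measurable_rem_part beta i : measurable_fun setT (rem_part beta i).
Proof.
apply: measurable_sum => j; apply: measurable_funM; last exact: measurable_sqnorm_powR.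
apply: measurable_funM; first exact: measurable_taylor_rem.
by apply: measurable_funM; exact: measurable_tnth_real.
Qed.

Lemma measurable_quad_part beta i : measurable_fun setT (quad_part beta i).
Proof.
apply: measurable_sum => j; apply: measurable_sum => k; apply: measurable_sum => l.
apply: measurable_funM => //; apply: measurable_funM; last exact: measurable_sqnorm_powR.
exact: measurable_monomial4.
Qed.

Lemma measurable_even_part beta i : measurable_fun setT (even_part beta i).
Proof.
by apply: measurable_funD; [exact: measurable_quad_part|exact: measurable_rem_part].
Qed.

(** [|w| ^ (4 + 2 s)], integrable over balls as soon as [0 < (n + 4) / 2 + s]; it
    bounds the parts of the integrand for suitable [s]. *)
Definition dominant (s : R) t : R := sqnorm t ^+ 2 * sqnorm t `^ s.

Lemma dominant_ge0 s t : 0 <= dominant s t.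
Proof. by rewrite mulr_ge0 ?powR_ge0// sqr_ge0. Qed.

Lemma dominant_half s t :
  Num.sqrt (sqnorm t) * dominant s t = dominant (s + 2^-1) t.
Proof.
rewrite /dominant; have [->|q0] := eqVneq (sqnorm t) 0.
  by rewrite expr0n !mul0r mulr0.
by rewrite powRD ?q0 ?implybT// powR12_sqrt ?sqnorm_ge0//; ring.
Qed.

Lemma taylor_rem_uniform (r e : R) : 0 < e ->
  exists2 K : R, 0 <= K & forall j w, enorm w <= r ->
    `|taylor2_rem (coord_fun u j) x w| <= e * enorm w ^+ 2 + K * enorm w ^+ 3.
Proof.
move=> e0.
have /choice[K KP] j : exists K : R, 0 <= K /\ forall w, enorm w <= r ->
    `|taylor2_rem (coord_fun u j) x w| <= e * enorm w ^+ 2 + K * enorm w ^+ 3.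
  by have [K K0 H] := @taylor2_rem_le R n (coord_fun u j) x r e (C2u j) e0; exists K.
exists (\sum_j K j); first by apply: sumr_ge0 => j _; exact: (KP j).1.
move=> j w wr; apply: le_trans ((KP j).2 w wr) _; rewrite lerD2l.
rewrite ler_wpM2r ?exprn_ge0 ?sqrtr_ge0// (bigD1 j)//= lerDl.
by apply: sumr_ge0 => l _; exact: (KP l).1.
Qed.

Lemma rem_part_le beta i (r e K : R) t :
  (forall j w, enorm w <= r ->
    `|taylor2_rem (coord_fun u j) x w| <= e * enorm w ^+ 2 + K * enorm w ^+ 3) ->
  enorm (row_of_tuple t) <= r ->
  `|rem_part beta i t| <=
  n%:R * (e * dominant (s_ beta) t + K * dominant (s_ beta + 2^-1) t).
Proof.
move=> H tr; apply: le_trans (ler_norm_sum _ _ _) _.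
rewrite mulr_natl -[X in _ *+ X]card_ord -sumr_const; apply: ler_sum => j _.
rewrite !normrM [`|_ `^ _|]ger0_norm ?powR_ge0// -dominant_half /dominant.
rewrite -normrM.
have qE : enorm (row_of_tuple t) ^+ 2 = sqnorm t.
  by rewrite enorm_row_of_tuple sqr_sqrtr// sqnorm_ge0.
have -> : e * (sqnorm t ^+ 2 * sqnorm t `^ s_ beta) +
   K * (Num.sqrt (sqnorm t) * (sqnorm t ^+ 2 * sqnorm t `^ s_ beta)) =
   (e * enorm (row_of_tuple t) ^+ 2 + K * enorm (row_of_tuple t) ^+ 3) * sqnorm t
     * sqnorm t `^ s_ beta.
  by rewrite (exprS _ 2) qE enorm_row_of_tuple; ring.
rewrite ler_wpM2r ?powR_ge0// ler_pM//; first exact: H.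
exact: ler_tnth_sqnorm.
Qed.

Lemma quad_part_le beta i t : `|quad_part beta i t| <=
  (\sum_j \sum_k \sum_l `|2^-1 * hessian j k l|) * dominant (s_ beta) t.
Proof.
rewrite mulr_suml; apply: le_trans (ler_norm_sum _ _ _) _; apply: ler_sum => j _.
rewrite mulr_suml; apply: le_trans (ler_norm_sum _ _ _) _; apply: ler_sum => k _.
rewrite mulr_suml; apply: le_trans (ler_norm_sum _ _ _) _; apply: ler_sum => l _.
rewrite normrM ler_wpM2l// normrM [`|_ `^ _|]ger0_norm ?powR_ge0//.
by rewrite ler_wpM2r ?powR_ge0// ler_monomial4.
Qed.

Lemma half_exponentE beta :
  (n%:R + 4) / 2 + s_ beta = (n%:R + 2 - beta) / 2 :> R.
Proof. by rewrite /kernel_exponent; field. Qed.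

Lemma half_exponent_gt0 beta : beta < n%:R + 2 ->
  0 < (n%:R + 4) / 2 + s_ beta :> R.
Proof. by move=> b; rewrite half_exponentE divr_gt0// subr_gt0. Qed.

(** On a ball the remainder is also of order [|w| ^ 2], so the even part is of
    order [|w| ^ (2 - beta)], integrable near [0] for [beta < n + 2]. *)
Lemma even_part_le beta delta : exists2 M : R, 0 <= M &
  forall i t, sqnorm t < delta ^+ 2 ->
    `|even_part beta i t| <= M * dominant (s_ beta) t.
Proof.
have [K K0 KP] := @taylor_rem_uniform `|delta| 1 ltr01.
exists (\sum_j \sum_k \sum_l `|2^-1 * hessian j k l| + n%:R * (1 + K * `|delta|)).
  apply: addr_ge0; last by rewrite mulr_ge0// addr_ge0// mulr_ge0.
  by apply: sumr_ge0 => j _; apply: sumr_ge0 => k _; apply: sumr_ge0.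
move=> i t td; apply: le_trans (ler_normD _ _) _; rewrite mulrDl.
apply: lerD; first exact: quad_part_le.
have sd : Num.sqrt (sqnorm t) <= `|delta|.
  by rewrite -sqrtr_sqr ler_wsqrtr// ltW.
apply: le_trans (@rem_part_le beta i `|delta| 1 K t KP _) _.
  by rewrite enorm_row_of_tuple.
rewrite -mulrA ler_wpM2l// mul1r mulrDl mul1r lerD2l -dominant_half -mulrA.
by rewrite ler_wpM2l// ler_wpM2r ?dominant_ge0.
Qed.

Lemma integrable_even_part beta delta i : beta < n%:R + 2 -> 0 < delta ->
  lebn.-integrable [set t | sqnorm t < delta ^+ 2] (EFin \o even_part beta i).
Proof.
move=> bn d0; have [M M0 MP] := even_part_le beta delta.
apply: (@integrable_dominated _ _ _ lebn _ _ _ (dominant (s_ beta)) M).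
- exact: measurable_sqnorm_ball.
- exact: measurable_even_part.
- by apply: integrable_sqnorm_power; rewrite ?exprn_gt0//; exact: half_exponent_gt0.
- by move=> t td; exact: MP.
Qed.

Definition grad_bound : R := \sum_j \sum_k `|partial k (coord_fun u j) x|.

Lemma odd_part_le beta i t : `|odd_part beta i t| <=
  grad_bound * (Num.sqrt (sqnorm t) * sqnorm t * sqnorm t `^ s_ beta).
Proof.
rewrite mulr_suml; apply: le_trans (ler_norm_sum _ _ _) _; apply: ler_sum => j _.
rewrite mulr_suml; apply: le_trans (ler_norm_sum _ _ _) _; apply: ler_sum => k _.
rewrite normrM ler_wpM2l// normrM [`|_ `^ _|]ger0_norm ?powR_ge0//.
rewrite ler_wpM2r ?powR_ge0// normrM ler_pM ?ler_tnth_sqnorm//.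
rewrite -sqrtr_sqr ler_wsqrtr// expr2.
by apply: le_trans (ler_norm _) _; exact: ler_tnth_sqnorm.
Qed.

(** The odd part is of order [|w| ^ (1 - beta)], integrable near [0] when
    [beta < n + 1]: half a unit is lost in the exponent of [|w| ^ 2]. *)
Lemma dominant_Nhalf s t :
  Num.sqrt (sqnorm t) * sqnorm t * sqnorm t `^ s = dominant (s - 2^-1) t.
Proof.
rewrite /dominant; have [->|q0] := eqVneq (sqnorm t) 0.
  by rewrite expr0n mulr0 !mul0r.
rewrite powRB ?q0 ?implybT// powR12_sqrt ?sqnorm_ge0//.
have r0 : Num.sqrt (sqnorm t) != 0.
  by rewrite sqrtr_eq0 -ltNge lt0r q0 sqnorm_ge0.
have qE : sqnorm t = Num.sqrt (sqnorm t) ^+ 2 by rewrite sqr_sqrtr// sqnorm_ge0.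
move: (sqnorm t `^ s) (Num.sqrt (sqnorm t)) qE r0 => c r -> r0; field.
exact: r0.
Qed.

Lemma sqnorm_opp t : sqnorm (tuple_dilation (fun=> -1) t) = sqnorm t.
Proof. by rewrite sqnorm_sign// => i; rewrite normrN1. Qed.

(** The odd part changes sign under [w |-> - w]. *)
Lemma Rintegral_bond_integrand_symmetric beta delta i (Om : set (n.-tuple Rm)) :
  beta < n%:R + 2 -> 0 < delta -> measurable Om ->
  Om `<=` [set t | sqnorm t < delta ^+ 2] ->
  (forall t, Om (tuple_dilation (fun=> -1) t) = Om t) ->
  lebn.-integrable Om (EFin \o odd_part beta i) ->
  \int[lebn]_(t in Om) bond_integrand beta u x (row_of_tuple t) ord0 i =
  \int[lebn]_(t in Om) even_part beta i t.
Proof.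
move=> bn d0 mO OB Os oi.
under eq_Rintegral do rewrite bond_integrand_decomp.
rewrite RintegralD//; last first.
  apply: integrableS (integrable_even_part beta delta i bn d0) => //.
  exact: measurable_sqnorm_ball.
rewrite (@Rintegral_odd _ _ (fun=> -1)) ?add0r//.
- by move=> j; rewrite normrN1.
- exact: measurable_odd_part.
- move=> t; rewrite /odd_part sqnorm_opp -sumrN; apply: eq_bigr => j _.
  by rewrite -sumrN; apply: eq_bigr => k _; rewrite !tnth_mktuple; ring.
Qed.

(** What is left out by the annuli of the principal value.  The closed ball of
    radius [eps] lies in the open ball of radius [2 eps]. *)
Lemma normr_Rintegral_even_part_core beta eps (M : R) i (N : set (n.-tuple Rm)) :
  beta < n%:R + 2 -> 0 < eps -> measurable N ->
  N `<=` [set t | sqnorm t < (2 * eps) ^+ 2] -> 0 <= M ->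
  (forall t, N t -> `|even_part beta i t| <= M * dominant (s_ beta) t) ->
  `|\int[lebn]_(t in N) even_part beta i t| <=
  M * (n%:R * (n%:R + 2) * radial_moment (n := n) ((2 * eps) ^+ 2) (s_ beta)).
Proof.
move=> bn e0 mN NB M0 MP.
have D0 : 0 < (2 * eps) ^+ 2 by rewrite exprn_gt0// mulr_gt0.
have iB := @integrable_sqnorm_power R n _ _ D0 (half_exponent_gt0 beta bn).
have iN : lebn.-integrable N (EFin \o dominant (s_ beta)).
  by apply: integrableS iB => //; exact: measurable_sqnorm_ball.
apply: le_trans (@normr_Rintegral_le _ _ _ lebn _ mN _ _ M _ iN MP) _.
  exact: measurable_even_part.
rewrite ler_wpM2l// -Rintegral_sqnorm_power//; last exact: half_exponent_gt0.
rewrite /Rintegral fine_le//.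
- exact: integrable_fin_num.
- by apply: integrable_fin_num => //; exact: measurable_sqnorm_ball.
- apply: ge0_subset_integral => //.
  + exact: measurable_sqnorm_ball.
  + by have [] := integrableP _ _ _ iB.
  + by move=> t _; rewrite lee_fin dominant_ge0.
Qed.

(** For [beta < n + 1] the odd part is integrable and cancels on the ball.  For
    larger [beta] it cancels on each annulus, where [eps < |w|] makes it
    integrable, and the integral of the even part over the ball [|w| <= eps] is
    [O(eps ^ (n + 2 - beta))]. *)
Lemma bond_integralE beta delta : beta < n%:R + 2 -> 0 < delta ->
  bond_integral delta beta u x =
  \row_i \int[lebn]_(t in [set t | sqnorm t < delta ^+ 2]) even_part beta i t.
Proof.
move=> bn d0; rewrite /bond_integral; case: ifPn => bn1.
  apply/rowP => i; rewrite !mxE enorm_ball_preimage//.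
  apply: (Rintegral_bond_integrand_symmetric beta delta) => //.
  - exact: measurable_sqnorm_ball.
  - by move=> t /=; rewrite sqnorm_opp.
  apply: (@integrable_dominated _ _ _ lebn _ _ _ (dominant (s_ beta - 2^-1)) grad_bound).
  - exact: measurable_sqnorm_ball.
  - exact: measurable_odd_part.
  - apply: integrable_sqnorm_power; first by rewrite exprn_gt0.
    by rewrite addrA half_exponentE; lra.
  - by move=> t _; rewrite -dominant_Nhalf odd_part_le.
apply: cvg_lim => //; apply: cvg_rowP => i; rewrite mxE.
have [M M0 MP] := even_part_le beta delta.
pose Om eps : set (n.-tuple Rm) :=
  [set t | eps ^+ 2 < sqnorm t] `&` [set t | sqnorm t < delta ^+ 2].
have mOm eps : measurable (Om eps).
  apply: measurableI; last exact: measurable_sqnorm_ball.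
  by apply: measurable_set_ltr => //; exact: measurable_sqnorm.
have annulus eps : 0 < eps ->
  rV_integral [set w | eps < enorm w < delta] (bond_integrand beta u x) ord0 i =
  \int[lebn]_(t in Om eps) even_part beta i t.
  move=> e0; rewrite mxE.
  have -> : row_of_tuple @^-1` [set w : V | eps < enorm w < delta] = Om eps.
    rewrite /Om -enorm_ball_preimage//; apply/seteqP; split => t /=.
      move=> /andP[te ->]; split => //; move: te; rewrite enorm_row_of_tuple.
      move=> te; have : eps ^+ 2 < Num.sqrt (sqnorm t) ^+ 2.
        by rewrite ltrXn2r ?nnegrE ?sqrtr_ge0// ltW.
      by rewrite sqr_sqrtr// sqnorm_ge0.
    move=> [te ->]; rewrite andbT enorm_row_of_tuple -[ltLHS]gtr0_norm// -sqrtr_sqr.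
    by rewrite ltr_sqrt// (lt_trans _ te)// exprn_gt0.
  apply: (Rintegral_bond_integrand_symmetric beta delta) => //.
  - by move=> t [].
  - by move=> t; rewrite /Om /= /setI /= sqnorm_opp.
  apply: (@integrable_dominated _ _ _ lebn _ _ _ (dominant (s_ beta)) (grad_bound / eps)).
  - exact: mOm.
  - exact: measurable_odd_part.
  - apply: integrableS (integrable_sqnorm_power (delta ^+ 2) (s_ beta) _ _) => //.
    + exact: measurable_sqnorm_ball.
    + by move=> t [].
    + by rewrite exprn_gt0.
    + exact: half_exponent_gt0.
  - move=> t [/= te _]; apply: le_trans (odd_part_le _ _ _) _.
    rewrite -[leRHS]mulrA ler_wpM2l//.
      by apply: sumr_ge0 => j _; apply: sumr_ge0.
    rewrite ler_pdivlMl// /dominant mulrA ler_wpM2r ?powR_ge0// mulrA expr2.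
    rewrite ler_wpM2r ?sqnorm_ge0//.
    have -> : sqnorm t = Num.sqrt (sqnorm t) * Num.sqrt (sqnorm t).
      by rewrite -expr2 sqr_sqrtr// sqnorm_ge0.
    rewrite [Num.sqrt (_ * _)]sqrtr_sqr ger0_norm ?sqrtr_ge0// ler_wpM2r ?sqrtr_ge0//.
    by rewrite -[leLHS]gtr0_norm// -sqrtr_sqr ler_wsqrtr// ltW.
pose p : R := (n%:R + 4) / 2 + s_ beta.
have p0 : 0 < p by exact: half_exponent_gt0.
pose C : R := M * (n%:R * (n%:R + 2) * radial_moment (n := n) 4 (s_ beta)).
have bound eps : 0 < eps ->
  `|\int[lebn]_(t in [set t | sqnorm t < delta ^+ 2]) even_part beta i t -
    \int[lebn]_(t in Om eps) even_part beta i t| <= C * eps `^ (p * 2).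
  move=> eps0.
  pose N : set (n.-tuple Rm) :=
    [set t | sqnorm t < delta ^+ 2] `\` [set t | eps ^+ 2 < sqnorm t].
  have mN : measurable N.
    apply: measurableD; first exact: measurable_sqnorm_ball.
    by apply: measurable_set_ltr => //; exact: measurable_sqnorm.
  have BE : [set t | sqnorm t < delta ^+ 2] = Om eps `|` N.
    by rewrite /Om /N setIC setUIDK.
  have ON : [disjoint Om eps & N].
    by apply/disj_setPS => t [[te _] [_ /(_ te)]].
  have iB := integrable_even_part beta delta i bn d0.
  rewrite BE Rintegral_setU//; last by rewrite -BE.
  rewrite addrC addKr.
  apply: le_trans (@normr_Rintegral_even_part_core beta eps M i N bn eps0 mN _ M0 _) _.
  - move=> t [_ /negP]; rewrite -leNgt /= => te; apply: le_lt_trans te _.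
    by rewrite exprMn -natrX ltr_pMl ?exprn_gt0// ltr1n.
  - by move=> t [td _]; exact: MP.
  have -> : radial_moment (n := n) ((2 * eps) ^+ 2) (s_ beta) =
      radial_moment (n := n) 4 (s_ beta) * eps `^ (p * 2).
    rewrite /radial_moment -/p exprMn -natrX powRM ?exprn_ge0 ?(ltW eps0)// mulrA.
    by rewrite -[eps ^+ 2]powR_mulrn ?(ltW eps0)// -powRrM [2%:R * p]mulrC.
  by rewrite /C !mulrA.
apply/cvgrPdist_le => e e0.
have /cvgrPdist_le/(_ e e0) : C * eps `^ (p * 2) @[eps --> 0^'+] --> 0.
  rewrite -[X in _ --> X](mulr0 C); apply: cvgM; first exact: cvg_cst.
  by apply: powR_cvg0; rewrite mulr_gt0.
move=> H; near=> eps.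
have eps0 : 0 < eps by near: eps; exact: nbhs_right_gt.
rewrite annulus//; apply: le_trans (bound _ eps0) _.
apply: le_trans (ler_norm _) _; rewrite -normrN -sub0r.
by near: eps; exact: H.
Unshelve. all: by end_near. Qed.

(** * The estimate behind both limits *)

Lemma integrable_quad_part beta delta i : beta < n%:R + 2 -> 0 < delta ->
  lebn.-integrable [set t | sqnorm t < delta ^+ 2] (EFin \o quad_part beta i).
Proof.
move=> bn d0; apply: (@integrable_dominated _ _ _ lebn _ _ _ (dominant (s_ beta))).
- exact: measurable_sqnorm_ball.
- exact: measurable_quad_part.
- by apply: integrable_sqnorm_power; rewrite ?exprn_gt0//; exact: half_exponent_gt0.
- by move=> t _; exact: quad_part_le.
Qed.

Lemma integrable_monomial4 beta delta k l j i : beta < n%:R + 2 -> 0 < delta ->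
  lebn.-integrable [set t | sqnorm t < delta ^+ 2]
    (EFin \o (fun t => monomial4 k l j i t * sqnorm t `^ s_ beta)).
Proof.
move=> bn d0; apply: (@integrable_dominated _ _ _ lebn _ _ _ (dominant (s_ beta)) 1).
- exact: measurable_sqnorm_ball.
- by apply: measurable_funM; [exact: measurable_monomial4|exact: measurable_sqnorm_powR].
- by apply: integrable_sqnorm_power; rewrite ?exprn_gt0//; exact: half_exponent_gt0.
- move=> t _; rewrite mul1r normrM [`|_ `^ _|]ger0_norm ?powR_ge0//.
  by rewrite ler_wpM2r ?powR_ge0// ler_monomial4.
Qed.

Lemma gradient_divergenceE i :
  gradient (divergence u) x ord0 i = \sum_j hessian j j i.
Proof.
rewrite mxE /partial.
have -> : divergence u = \sum_j partial j (coord_fun u j).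
  by apply/funext => y; rewrite fct_sumE.
rewrite derive_sum// => j; exact: (Ck_derivable _ _ _ _ (Ck_partial _ _ _ (C2u j))).
Qed.

(** Contraction of an array with the isotropic tensor of rank 4. *)
Lemma sum_kronecker_pairings (H : 'I_n -> 'I_n -> 'I_n -> R) i :
  (forall j, H j i j = H j j i) ->
  \sum_j \sum_k \sum_l H j k l *
    (((k == l) && (j == i))%:R + ((k == j) && (l == i))%:R
     + ((k == i) && (l == j))%:R) =
  \sum_k H i k k + 2 * \sum_j H j j i.
Proof.
move=> Hsym.
have pick (F : 'I_n -> R) a : \sum_l F l * (l == a)%:R = F a.
  rewrite (bigD1 a)//= eqxx mulr1 big1 ?addr0// => l /negbTE ->.
  by rewrite mulr0.
transitivity (\sum_j \sum_k H j k k * (j == i)%:R +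
   \sum_j \sum_k H j k i * (k == j)%:R +
   \sum_j \sum_k H j k j * (k == i)%:R).
  rewrite -!big_split/=; apply: eq_bigr => j _; rewrite -!big_split/=.
  apply: eq_bigr => k _.
  under eq_bigr do rewrite !mulrDr; rewrite !big_split/=; congr (_ + _ + _).
  - rewrite -(pick (fun l => H j k l * (j == i)%:R) k).
    by apply: eq_bigr => l _; rewrite -mulnb natrM (eq_sym l); ring.
  - rewrite -(pick (fun l => H j k l * (k == j)%:R) i).
    by apply: eq_bigr => l _; rewrite -mulnb natrM; ring.
  - rewrite -(pick (fun l => H j k l * (k == i)%:R) j).
    by apply: eq_bigr => l _; rewrite -mulnb natrM; ring.
rewrite [2 * _]mulr_natl mulr2n addrA; congr (_ + _ + _).
- under eq_bigr do rewrite -mulr_suml.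
  exact: (pick (fun j => \sum_k H j k k)).
- by apply: eq_bigr => j _; exact: (pick (fun k => H j k i)).
- by apply: eq_bigr => j _; rewrite (pick (fun k => H j k j)).
Qed.

Lemma laplacianE i : laplacian u x ord0 i = \sum_k hessian i k k.
Proof. by rewrite mxE. Qed.

(** The isotropic moment tensor contracts the Hessian of [u] to
    [Delta u + 2 grad (div u)]; symmetry of second derivatives merges the two
    pairings that involve different components of [u]. *)
Lemma Rintegral_quad_part beta delta i : beta < n%:R + 2 -> 0 < delta ->
  \int[lebn]_(t in [set t | sqnorm t < delta ^+ 2]) quad_part beta i t =
  2^-1 * radial_moment (n := n) (delta ^+ 2) (s_ beta) *
  (laplacian u x ord0 i + 2 * gradient (divergence u) x ord0 i).
Proof.
move=> bn d0.
have mB := @measurable_sqnorm_ball R n (delta ^+ 2).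
have D0 : 0 < delta ^+ 2 by rewrite exprn_gt0.
have int3 j k l : lebn.-integrable [set t | sqnorm t < delta ^+ 2]
    (EFin \o (fun t => 2^-1 * hessian j k l * (monomial4 k l j i t * sqnorm t `^ s_ beta))).
  by apply: integrable_scale => //; exact: integrable_monomial4.
rewrite laplacianE gradient_divergenceE -sum_kronecker_pairings; last first.
  by move=> j; exact: partialC (C2u j).
rewrite mulr_sumr Rintegral_bigsum//; last first.
  by move=> j; apply: integrable_bigsum => // k; exact: integrable_bigsum.
apply: eq_bigr => j _; rewrite mulr_sumr Rintegral_bigsum//; last first.
  by move=> k; exact: integrable_bigsum.
apply: eq_bigr => k _; rewrite mulr_sumr Rintegral_bigsum//.
apply: eq_bigr => l _; rewrite RintegralZl//; last exact: integrable_monomial4.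
rewrite Rintegral_monomial4//; last exact: half_exponent_gt0.
ring.
Qed.

Lemma Rintegral_rem_part_le beta delta i (e K : R) :
  beta < n%:R + 2 -> 0 < delta ->
  (forall j w, enorm w <= delta ->
    `|taylor2_rem (coord_fun u j) x w| <= e * enorm w ^+ 2 + K * enorm w ^+ 3) ->
  lebn.-integrable [set t | sqnorm t < delta ^+ 2] (EFin \o rem_part beta i) /\
  `|\int[lebn]_(t in [set t | sqnorm t < delta ^+ 2]) rem_part beta i t| <=
  n%:R * (n%:R * (n%:R + 2)) *
    (e * radial_moment (n := n) (delta ^+ 2) (s_ beta) +
     K * radial_moment (n := n) (delta ^+ 2) (s_ beta + 2^-1)).
Proof.
move=> bn d0 HK.
have mB := @measurable_sqnorm_ball R n (delta ^+ 2).
have D0 : 0 < delta ^+ 2 by rewrite exprn_gt0.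
have p0 := half_exponent_gt0 beta bn.
have p1 : 0 < (n%:R + 4) / 2 + (s_ beta + 2^-1) :> R by rewrite addrA addr_gt0.
have i0 := integrable_sqnorm_power _ _ D0 p0.
have i1 := integrable_sqnorm_power _ _ D0 p1.
pose g t := e * dominant (s_ beta) t + K * dominant (s_ beta + 2^-1) t.
have ig : lebn.-integrable [set t | sqnorm t < delta ^+ 2] (EFin \o g).
  by apply: integrable_add => //; exact: integrable_scale.
have le_g t : [set t | sqnorm t < delta ^+ 2] t -> `|rem_part beta i t| <= n%:R * g t.
  move=> td; apply: (rem_part_le beta i delta e K t HK).
  by have : [set w : V | enorm w < delta] (row_of_tuple t);
    [move: td; rewrite -enorm_ball_preimage|exact: ltW].
have mr := measurable_rem_part beta i.
split; first exact: (@integrable_dominated _ _ _ lebn _ mB _ g n%:R).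
apply: le_trans (@normr_Rintegral_le _ _ _ lebn _ mB _ g n%:R mr ig le_g) _.
rewrite RintegralD//; [|exact: integrable_scale..].
rewrite !RintegralZl// !Rintegral_sqnorm_power//.
by rewrite le_eqVlt; apply/orP; left; apply/eqP; ring.
Qed.

(** Normalization.  With [a = 0] the right-hand side is [2], which cancels the
    [1 / 2] of the Taylor formula; with [a = 1] it is at most
    [2 (n + 2 - beta) delta], which vanishes in both limits. *)
Lemma scaling_const_radial_moment beta delta (i : 'I_n) (a : R) :
  beta < n%:R + 2 -> 0 < delta -> 0 <= a ->
  (n%:R + 2) * scaling_const n delta beta *
    radial_moment (n := n) (delta ^+ 2) (s_ beta + a / 2) =
  2 * (n%:R + 2 - beta) / (n%:R + 2 - beta + a) * delta `^ a.
Proof.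
move=> bn d0 a0.
have [G0 _] := @quartic_ball R n i i; have n0 : 0 <= n%:R :> R by [].
rewrite /scaling_const /radial_moment /moment_const.
have -> : (n%:R + 4) / 2 + (s_ beta + a / 2) = (n%:R + 2 - beta + a) / 2.
  by rewrite addrA half_exponentE; field.
have -> : (delta ^+ 2) `^ ((n%:R + 2 - beta + a) / 2) =
    delta `^ (n%:R + 2 - beta) * delta `^ a.
  rewrite -[delta ^+ 2]powR_mulrn ?(ltW d0)// -powRrM -powRD; last first.
    by rewrite (gt_eqF d0) implybT.
  by congr (_ `^ _); field.
have pi0 : 0 < pi `^ (n%:R / 2) :> R by rewrite powR_gt0// pi_gt0.
have dp0 : 0 < delta `^ (n%:R + 2 - beta) by rewrite powR_gt0.
field.
rewrite !gt_eqF//=; lra.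
Qed.

Lemma scaling_const_gt0 beta delta (i : 'I_n) : beta < n%:R + 2 -> 0 < delta ->
  0 < scaling_const n delta beta.
Proof.
move=> bn d0; have [G0 _] := @quartic_ball R n i i.
by rewrite divr_gt0 ?mulr_gt0 ?subr_gt0 ?powR_gt0 ?pi_gt0.
Qed.

(** The quadratic part of the expansion reproduces the limit exactly, hence the
    error comes from the remainder alone.  The constant [K] depends neither on
    [delta <= r] nor on [beta]. *)
Lemma bond_operator_estimate (mu r e : R) : 0 < e ->
  exists2 K : R, 0 <= K & forall delta beta, 0 < delta -> delta <= r ->
    beta < n%:R + 2 ->
    `|bond_operator mu delta beta u x -
      (mu *: laplacian u x + (2 * mu) *: gradient (divergence u) x)| <=
    e + K * ((n%:R + 2 - beta) * delta).
Proof.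
move=> e0.
pose A : R := n%:R * (n%:R * (n%:R + 2)).
have A0 : 0 <= A by rewrite !mulr_ge0// addr_ge0.
pose N : R := `|mu| * A * 2.
have N0 : 0 <= N by rewrite !mulr_ge0.
pose e' := e / (N + 1).
have e'0 : 0 < e' by rewrite divr_gt0// ltr_wpDl.
have [K K0 KP] := @taylor_rem_uniform r e' e'0.
exists (N * K); first exact: mulr_ge0.
move=> delta beta d0 dr bn.
apply: norm_le_coord => [|i].
  by rewrite addr_ge0 ?(ltW e0)// !mulr_ge0// ?(ltW d0)// subr_ge0 ltW.
have [ir rem_le] := @Rintegral_rem_part_le beta delta i e' K bn d0
  (fun j w wd => KP j w (le_trans wd dr)).
have mB := @measurable_sqnorm_ball R n (delta ^+ 2).
have iq := integrable_quad_part beta delta i bn d0.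
have coordE (c a b : R) (f : 'I_n -> R) (v w : V) :
  (c *: (\row_j f j) - (a *: v + b *: w)) ord0 i =
  c * f i - (a * v ord0 i + b * w ord0 i) by rewrite !mxE.
rewrite /bond_operator bond_integralE// coordE.
rewrite RintegralD// Rintegral_quad_part//.
set c := scaling_const n delta beta.
set T := radial_moment _ (s_ beta) in rem_le *.
set T' := radial_moment _ (s_ beta + _) in rem_le.
set I := \int[_]_(t in _) rem_part beta i t in rem_le *.
have cT : (n%:R + 2) * c * T = 2.
  have := scaling_const_radial_moment beta delta i 0 bn d0 (lexx _).
  rewrite mul0r !addr0 powRr0 mulr1 mulfK//.
  by rewrite gt_eqF// subr_gt0.
have z0 : 0 < n%:R + 2 - beta by rewrite subr_gt0.
have cT' : (n%:R + 2) * c * T' <= 2 * ((n%:R + 2 - beta) * delta).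
  have := scaling_const_radial_moment beta delta i 1 bn d0 ler01.
  rewrite div1r => ->; rewrite powRr1 ?(ltW d0)// mulrA ler_wpM2r ?(ltW d0)//.
  rewrite ler_piMr ?mulr_ge0 ?(ltW z0)// invf_le1 ?(addr_gt0 z0 ltr01)//.
  by rewrite lerDr ltW.
have c0 : 0 <= (n%:R + 2) * c.
  by rewrite mulr_ge0 ?addr_ge0// ltW//; exact: scaling_const_gt0.
set L := laplacian u x ord0 i; set G := gradient (divergence u) x ord0 i.
have -> : (n%:R + 2) * mu * c * (2^-1 * T * (L + 2 * G) + I) - (mu * L + 2 * mu * G) =
    mu * ((n%:R + 2) * c * I) + mu * (L + 2 * G) * (2^-1 * ((n%:R + 2) * c * T) - 1).
  ring.
rewrite cT mulVf// subrr mulr0 addr0 normrM normrM (ger0_norm c0).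
apply: (@le_trans _ _ (`|mu| * ((n%:R + 2) * c * (A * (e' * T + K * T'))))).
  by rewrite ler_wpM2l// ler_wpM2l.
have -> : (n%:R + 2) * c * (A * (e' * T + K * T')) =
    A * (e' * ((n%:R + 2) * c * T) + K * ((n%:R + 2) * c * T')) by ring.
rewrite cT.
apply: (@le_trans _ _ (`|mu| * (A * (e' * 2 + K * (2 * ((n%:R + 2 - beta) * delta)))))).
  by rewrite ler_wpM2l// ler_wpM2l// lerD2l ler_wpM2l.
have -> : `|mu| * (A * (e' * 2 + K * (2 * ((n%:R + 2 - beta) * delta)))) =
    N * e' + N * K * ((n%:R + 2 - beta) * delta) by rewrite /N; ring.
rewrite lerD2r /e' mulrCA ler_piMr ?(ltW e0)//.
by rewrite ler_pdivrMr ?ltr_wpDl// mul1r lerDl.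
Qed.

End bond.

(** * The local limit *)

Theorem theorem10 (R : realType) (n : nat) (mu : R)
    (u : 'rV[R]_n -> 'rV[R]_n) (x : 'rV[R]_n) :
  (1 <= n)%N ->
  (forall i : 'I_n, Ck 3 (coord_fun u i)) ->
  (forall beta : R, beta < n%:R + 2 ->
     bond_operator mu delta beta u x @[delta --> 0^'+] -->
       mu *: laplacian u x + (2 * mu) *: gradient (divergence u) x) /\
  (forall delta : R, 0 < delta ->
     bond_operator mu delta beta u x @[beta --> (n%:R + 2)^'-] -->
       mu *: laplacian u x + (2 * mu) *: gradient (divergence u) x).
Proof.
move=> _ C3u; have C2u i : Ck 2 (coord_fun u i) by exact: Ck_pred.
split=> [beta bn|delta d0]; apply/cvgrPdist_le => e e0;
  have e2 : 0 < e / 2 by rewrite divr_gt0.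
- have [K K0 KP] := @bond_operator_estimate R n u x C2u mu 1 (e / 2) e2.
  have z0 : 0 <= n%:R + 2 - beta by rewrite subr_ge0 ltW.
  have q0 : 0 < K * (n%:R + 2 - beta) + 1 by rewrite ltr_wpDl// mulr_ge0.
  near=> delta; rewrite distrC.
  have d0 : 0 < delta by near: delta; exact: nbhs_right_gt.
  have d1 : delta <= 1 by near: delta; exact: nbhs_right_le.
  have : delta <= e / 2 / (K * (n%:R + 2 - beta) + 1).
    by near: delta; apply: nbhs_right_le; exact: divr_gt0.
  rewrite ler_pdivlMr// => de.
  apply: le_trans (KP delta beta d0 d1 bn) _; rewrite [leRHS]splitr lerD2l.
  apply: le_trans de; rewrite mulrA mulrC ler_wpM2l ?(ltW d0)//.
  by rewrite lerDl.
- have [K K0 KP] := @bond_operator_estimate R n u x C2u mu delta (e / 2) e2.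
  have q0 : 0 < K * delta + 1 by rewrite ltr_wpDl// mulr_ge0// ltW.
  near=> beta; rewrite distrC.
  have bn : beta < n%:R + 2 by near: beta; exact: nbhs_left_lt.
  have : n%:R + 2 - e / 2 / (K * delta + 1) <= beta.
    near: beta; apply: nbhs_left_ge; rewrite ltrBlDr ltrDl; exact: divr_gt0.
  rewrite lerBlDr -lerBlDl ler_pdivlMr// => be.
  apply: le_trans (KP delta beta d0 (lexx _) bn) _; rewrite [leRHS]splitr lerD2l.
  apply: le_trans be; rewrite mulrCA ler_wpM2l ?subr_ge0 ?(ltW bn)//.
  by rewrite lerDl.
Unshelve. all: by end_near. Qed.
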